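(* Let $d\ge1$, $\alpha>1$, let $\boldsymbol{\gamma}_d=(\gamma_{d,1},\ldots,\gamma_{d,d})$ satisfy $1\ge\gamma_{d,1}\ge\ldots\ge\gamma_{d,d}>0$, and let $N\ge1$. Let $\Lambda=\Lambda(\boldsymbol{z}_1,M_1,\ldots,\boldsymbol{z}_L,M_L)$ be a multiple rank-1 lattice such that, with $I=A_d(N)$: $I=\bigcup_{\ell=1}^LI_\ell$; $L\le\max(3\ln|A_d(N)|,1)$; $M_1=\ldots=M_L\le3|A_d(N)|$; and the total number of sampling values $M:=|\Lambda|$ satisfies $2|A_d(N)|<M<9|A_d(N)|\max(\ln|A_d(N)|,1)$. Then for all $\tau\in(1/\alpha,1)$ and all $\delta\in(0,1)$ $$\sup_{\|f|\mathcal{H}_{\alpha,\boldsymbol{\gamma}_d}(\mathbb{T}^d)\|\le1}\|f-\operatorname{S}_{A_d(N)}^\Lambda f\,|\,L_\infty(\mathbb{T}^d)\|<4\cdot3^{1/\tau-1}(\ln M)^{\frac{1+\tau}{2\tau}}M^{\frac{\tau-1}{2\tau}}\sqrt{\frac{\tau}{1-\tau}}\prod_{j=1}^d\left(1+2\zeta(\alpha\tau)\gamma_{d,j}^\tau\right)^{\frac1{2\tau}}$$ $$\le4\cdot3^{1/\tau-1}\delta^{-\frac{1+\tau}{2\tau}}M^{\frac{1+\delta}{2}-\frac{1-\delta}{2\tau}}\sqrt{\frac{\tau}{1-\tau}}\prod_{j=1}^d\left(1+2\zeta(\alpha\tau)\gamma_{d,j}^\tau\right)^{\frac1{2\tau}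}.$$
   Context: $\zeta$ is the Riemann zeta function, $\mathbb{T}\sim[0,1)$, and $c_{\boldsymbol{h}}(f)=\int_{\mathbb{T}^d}f(\boldsymbol{x})\mathrm{e}^{-2\pi\mathrm{i}\boldsymbol{h}\cdot\boldsymbol{x}}\,\mathrm{d}\boldsymbol{x}$. The weight function is $r_d(\alpha,\boldsymbol{\gamma}_d,\boldsymbol{h})=\prod_{j=1}^d\max(1,\gamma_{d,j}^{-1}|h_j|^\alpha)$ for $\boldsymbol{h}\in\mathbb{Z}^d$. The weighted Korobov space $\mathcal{H}_{\alpha,\boldsymbol{\gamma}_d}(\mathbb{T}^d)$ consists of all $f\in L_1(\mathbb{T}^d)$ with $\|f|\mathcal{H}_{\alpha,\boldsymbol{\gamma}_d}(\mathbb{T}^d)\|=\left(\sum_{\boldsymbol{h}\in\mathbb{Z}^d}r_d(\alpha,\boldsymbol{\gamma}_d,\boldsymbol{h})|c_{\boldsymbol{h}}(f)|^2\right)^{1/2}<\infty$; functions are identified with their continuous representatives, and point values refer to these. The frequency sets are $A_d(N)=\{\boldsymbol{h}\in\mathbb{Z}^d\colon r_d(\alpha,\boldsymbol{\gamma}_d,\boldsymbol{h})\le N\}$. For $\boldsymbol{z}\in\mathbb{Z}^d$, $M'\in\mathbb{N}$, the rank-1 lattice is $\Lambda(\boldsymbol{z},M')=\{\frac{j}{M'}\boldsymbol{z}\bmod\boldsymbol{1}\colon j=0,\ldots,M'-1\}\subset\mathbb{T}^d$; a multiple rank-1 lattice is $\Lambda(\boldsymbol{z}_1,M_1,\ldots,\boldsymbol{z}_L,M_L)=\bigcup_{\ell=1}^L\Lambda(\boldsymbol{z}_\ell,M_\ell)$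 with $L\in\mathbb{N}$, $\boldsymbol{z}_\ell\in\mathbb{Z}^d$, $M_\ell\in\mathbb{N}$. Given a finite $I\subset\mathbb{Z}^d$ and these parameters, define recursively the pairwise disjoint sets $$I_\ell=\Big\{\boldsymbol{h}\in I\setminus\bigcup_{j=1}^{\ell-1}I_j\colon \boldsymbol{h}\cdot\boldsymbol{z}_\ell\not\equiv\boldsymbol{k}\cdot\boldsymbol{z}_\ell\ (\mathrm{mod}\ M_\ell)\text{ for all }\boldsymbol{k}\in I\setminus\{\boldsymbol{h}\}\Big\},\quad\ell=1,\ldots,L,$$ and $$\operatorname{S}_I^\Lambda f(\boldsymbol{x})=\sum_{\ell=1}^L\sum_{\boldsymbol{h}\in I_\ell}\hat f_{\boldsymbol{h}}\,\mathrm{e}^{2\pi\mathrm{i}\boldsymbol{h}\cdot\boldsymbol{x}},\qquad \hat f_{\boldsymbol{h}}=\frac{1}{M_\ell}\sum_{j=0}^{M_\ell-1}f\Big(\frac{j\boldsymbol{z}_\ell}{M_\ell}\Big)\mathrm{e}^{-2\pi\mathrm{i}j\,\boldsymbol{h}\cdot\boldsymbol{z}_\ell/M_\ell}\quad\text{for }\boldsymbol{h}\in I_\ell.$$ *)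

(* Defs.v *)
From HB Require Import structures.
From mathcomp Require Import all_boot all_order all_algebra.
From mathcomp Require Import complex finmap.
From mathcomp Require Import all_classical all_reals all_analysis.
Set Implicit Arguments.
Unset Strict Implicit.
Unset Printing Implicit Defensive.
Import Order.TTheory GRing.Theory Num.Theory.
Import numFieldNormedType.Exports.
Local Open Scope classical_set_scope.
Local Open Scope complex_scope.
Local Open Scope ring_scope.

Section TorusMeasure.
Variable R : realType.
Local Notation RB := (measurableTypeR R).

Definition tuple_cons n (p : RB * n.-tuple RB) : n.+1.-tuple RB :=
  [the n.+1.-tuple RB of p.1 :: p.2].

Lemma measurable_tuple_cons n : measurable_fun setT (@tuple_cons n).
Proof. by apply: measurable_cons. Qed.

HB.instance Definition _ n :=
  isMeasurableFun.Build _ _ _ _ (@tuple_cons n) (@measurable_tuple_cons n).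

(* Lebesgue measure on T^d, as the d-fold product of the uniform distribution
   on [0,1]; it lives on d-tuples of reals and the complement of [0,1)^d is a
   null set, so that integrals over the whole type are integrals over T^d. *)
Fixpoint torus_measure (d : nat) : probability (d.-tuple RB) R :=
  match d return probability (d.-tuple RB) R with
  | 0%N => \d_([tuple] : 0.-tuple RB)
  | n.+1 => distribution
      (uniform_prob (@ltr01 R) \x torus_measure n)%E (@tuple_cons n)
  end.

End TorusMeasure.

Section Korobov.
Variables (R : realType) (d : nat).
Local Notation C := R[i].
Local Notation pt := (d.-tuple (measurableTypeR R)).
Local Notation freq := (d.-tuple int).
Local Notation mu := (torus_measure R d).

Definition expi (t : R) : C := cos (2 * pi * t) +i* sin (2 * pi * t).

Definition dotx (h : freq) (x : pt) : R :=
  \sum_(j < d) (tnth h j)%:~R * tnth x j.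

Definition dotz (h k : freq) : int := \sum_(j < d) tnth h j * tnth k j.

(* x mod 1, the representative in [0,1)^d of the class of x in R^d / Z^d *)
Definition mod1 (x : pt) : pt :=
  [tuple tnth x j - (Num.floor (tnth x j))%:~R | j < d].

(* A function on T^d is given by a function on R^d of which only the values on
   [0,1)^d matter. *)
Definition L1_torus (f : pt -> C) : Prop :=
  mu.-integrable setT (EFin \o (fun x => complex.Re (f x))) /\
  mu.-integrable setT (EFin \o (fun x => complex.Im (f x))).

Definition integral_torus (f : pt -> C) : C :=
  (\int[mu]_x complex.Re (f x)) +i* (\int[mu]_x complex.Im (f x)).

Definition fourier_coef (f : pt -> C) (h : freq) : C :=
  integral_torus (fun x => f x * expi (- dotx h x)).

(* Continuity for the topology of R^d / Z^d: continuity on R^d of the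
   1-periodic extension of the values on [0,1)^d. *)
Definition continuous_torus (f : pt -> C) : Prop :=
  let F (y : 'rV[R]_d) := f (mod1 [tuple y ord0 j | j < d]) in
  continuous (fun y => complex.Re (F y)) /\
  continuous (fun y => complex.Im (F y)).

(* The values on [0,1)^d of the continuous representative of f are unique when
   it exists; the default value is the zero function. *)
Definition continuous_rep (f : pt -> C) : pt -> C :=
  xget (fun=> 0) [set g | continuous_torus g /\ \forall x \ae mu, f x = g x].

Definition Linfty_norm (f : pt -> C) : \bar R :=
  Lnorm mu +oo%E (fun x => (Normc.normc (f x))%:E).

Definition weight (alpha : R) (gamma : 'I_d -> R) (h : freq) : R :=
  \prod_(j < d) Num.max 1 ((gamma j)^-1 * `|(tnth h j)%:~R| `^ alpha).

Definition korobov_norm (alpha : R) (gamma : 'I_d -> R) (f : pt -> C) : \bar R :=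
  ((\esum_(h in [set: freq])
     (weight alpha gamma h * Normc.normc (fourier_coef f h) ^+ 2)%:E)
    `^ 2^-1)%E.

Definition korobov (alpha : R) (gamma : 'I_d -> R) : set (pt -> C) :=
  [set f | L1_torus f /\ (korobov_norm alpha gamma f < +oo)%E].

Definition freq_set (alpha : R) (gamma : 'I_d -> R) (N : R) : set freq :=
  [set h | weight alpha gamma h <= N].

Definition lattice_point (z : freq) (m j : nat) : pt :=
  mod1 [tuple j%:R / m%:R * (tnth z i)%:~R | i < d].

Definition rank1_lattice (z : freq) (m : nat) : set pt :=
  [set lattice_point z m j | j in [set j | (j < m)%N]].

Section MultipleRank1Lattice.
Variables (L : nat) (z : 'I_L -> freq) (m : 'I_L -> nat).

Definition multiple_rank1_lattice : set pt :=
  \bigcup_(l in [set: 'I_L]) rank1_lattice (z l) (m l).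

Variable I : set freq.

(* The elements of I not in J that do not alias, modulo the l-th lattice, with
   any other element of I. *)
Definition alias_free (J : set freq) (l : 'I_L) : set freq :=
  [set h | [/\ I h, ~ J h & forall k, I k -> k <> h ->
     ~ (dotz h (z l) = dotz k (z l) %[mod (m l)%:Z])%Z]].

(* The union of the first n of the sets I_l *)
Fixpoint freq_upto (n : nat) : set freq :=
  if n is n'.+1 then
    freq_upto n' `|`
    \bigcup_(l in [set l : 'I_L | l = n' :> nat]) alias_free (freq_upto n') l
  else set0.

(* I_l; the lattices are numbered from 0 *)
Definition freq_part (l : 'I_L) : set freq := alias_free (freq_upto l) l.

Definition lattice_coef (f : pt -> C) (l : 'I_L) (h : freq) : C :=
  (m l)%:R^-1 * \sum_(j < m l) f (lattice_point (z l) (m l) j) *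
    expi (- (j%:R * (dotz h (z l))%:~R / (m l)%:R)).

Definition lattice_approx (f : pt -> C) (x : pt) : C :=
  \sum_(l < L) \sum_(h \in freq_part l) lattice_coef f l h * expi (dotx h x).

End MultipleRank1Lattice.

End Korobov.

(* Meaningful for finite A only: fset_set A is empty for infinite A. *)
Definition card_set (T : choiceType) (A : set T) : nat := #|` fset_set A|.

(* Only meant for real s > 1, where the series converges. *)
Definition zeta (R : realType) (s : R) : R :=
  limn (series (fun n : nat => (n.+1%:R `^ s)^-1)).

(* Main.v *)
Require Import Defs.
From mathcomp Require Import all_boot all_order all_algebra.
From mathcomp Require Import complex finmap ring lra zify.
From mathcomp Require Import all_classical all_reals all_analysis.
From mathcomp Require Import measurable_realfun ess_sup_inf.
Set Implicit Arguments.
Unset Strict Implicit.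
Unset Printing Implicit Defensive.
Import Order.TTheory GRing.Theory Num.Theory.
Import numFieldNormedType.Exports.
Local Open Scope classical_set_scope.
Local Open Scope ring_scope.

(** A function f in the unit ball has square-summable weighted coefficients, and
    the reciprocal weights are summable, so the coefficients of f are absolutely
    summable (Cauchy-Schwarz).  Their Fourier series converges uniformly to a
    continuous function G, and f = G almost everywhere because an integrable
    function on the torus is determined by its coefficients
    (fourier_uniqueness).  Two continuous functions on the torus that agree
    almost everywhere agree at every point, so the samples used by the algorithm
    are those of G (continuous_repP).

    Uniqueness of coefficients is a monotone class argument.  The bounded
    pointwise limits of trigonometric polynomials form an algebra (trig_mul);
    with each function it contains its sign, hence indicators of sets described
    by sines and cosines, hence those of all measurable sets
    (measurable_trig_set).  A function orthogonal to the characters is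
    orthogonal to all of them.

    The error is estimated character by character.  The algorithm reproduces
    the character of a frequency in the index set A and maps any other character
    to a sum of at most L characters, one for each lattice.  Hence the error is
    at most (1 + L) times the sum of |c_h| over h outside A
    (lattice_error_series), which by Cauchy-Schwarz leaves the sum of 1 / r(h)
    outside A.

    That sum is controlled by counting.  Let S be the product of the factors
    1 + 2 zeta(alpha tau) gamma_j^tau; it bounds the sum of r(h)^(-tau) over Z^d
    (sum_weight_powR_le), so at most S t^tau frequencies have weight at most t.
    In increasing order the n-th weight is therefore at least (n/S)^(1/tau), and
    comparison with an integral bounds the sum over the complement of A by
    S^(1/tau) |A|^(1-1/tau) tau/(1-tau) (sum_weight_inv_le).  What remains is to
    express L and |A| through M (lattice_constant_lt, ln_powR_le). *)

(** * Boxes in the torus *)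

Lemma uniform_prob_sub01 (R : realType) (A : set (measurableTypeR R)) :
  measurable A -> A `<=` `[0, 1]%classic ->
  uniform_prob (@ltr01 R) A = lebesgue_measure A.
Proof.
move=> mA sA; rewrite /uniform_prob (eq_integral (cst 1%:E)); last first.
  move=> x; rewrite inE => /sA /=; rewrite in_itv/= => x01.
  by rewrite /uniform_pdf x01 subr0 invr1.
by rewrite integral_cst// mul1e.
Qed.

Lemma measurable_box (R : realType) d (I : 'I_d -> set (measurableTypeR R)) :
  (forall j, measurable (I j)) ->
  measurable [set x : d.-tuple (measurableTypeR R) | forall j, I j (tnth x j)].
Proof.
move=> mI; rewrite (_ : mkset _ =
    \bigcap_(j in [set: 'I_d]) ((@tnth d (measurableTypeR R))^~ j @^-1` I j)).
  apply: fin_bigcap_measurable; first exact: finite_finset.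
  move=> j _; rewrite -[X in measurable X]setTI.
  exact: measurable_tnth.
by apply/seteqP; split=> [x h j _|x h j]; apply: h.
Qed.

Lemma torus_measure_boxS (R : realType) n (I : 'I_n.+1 -> set (measurableTypeR R)) :
  (forall j, measurable (I j)) ->
  torus_measure R n.+1 [set x | forall j, I j (tnth x j)] =
  (uniform_prob (@ltr01 R) (I ord0) *
   torus_measure R n [set x | forall j, I (lift ord0 j) (tnth x j)])%E.
Proof.
move=> mI /=; rewrite /distribution /pushforward /=.
rewrite -product_measure1E//; last first.
  by apply: (measurable_box (I := fun j => I (lift ord0 j))) => j; exact: mI.
congr (_ _); apply/seteqP; split=> [[a x] h|[a x] [/= h0 h] j]/=.
  split=> /=; first exact: (h ord0).
  move=> j; have /= := h (lift ord0 j).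
  by rewrite tnthS.
by case: (unliftP ord0 j) => [k ->|->]; rewrite ?tnth0 ?tnthS.
Qed.

(** Ensures that no point of the fundamental cube is invisible to the measure,
    even on its lower faces: every cube point is a corner of such boxes. *)
Lemma torus_measure_itvoo_gt0 (R : realType) d (a b : 'I_d -> R) :
  (forall j, 0 <= a j) -> (forall j, a j < b j) -> (forall j, b j <= 1) ->
  (0 < torus_measure R d [set x | forall j, (a j < tnth x j < b j)%R])%E.
Proof.
elim: d a b => [|d IH] a b a0 ab b1.
  by rewrite /= diracE mem_set ?lte01 // => -[].
pose I j := `]a j, b j[%classic : set (measurableTypeR R).
have sI j : I j `<=` `[0, 1]%classic.
  move=> t; rewrite /I /= !in_itv /= => /andP[/ltW h1 /ltW h2].
  by rewrite (le_trans (a0 j) h1) (le_trans h2 (b1 j)).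
have mI j : measurable (I j) by exact: measurable_itv.
rewrite (_ : mkset _ = [set x | forall j, I j (tnth x j)]); last first.
  by apply/seteqP; split=> x h j; have := h j; rewrite /I /= in_itv.
rewrite torus_measure_boxS // mule_gt0 //.
  rewrite uniform_prob_sub01 //; have -> := lebesgue_measure_itv `](a ord0), (b ord0)[.
  by rewrite /= lte_fin ab -EFinD lte_fin subr_gt0.
rewrite (_ : mkset _ = [set x | forall j, a (lift ord0 j) < tnth x j < b (lift ord0 j)]).
  by apply: (IH (a \o lift ord0) (b \o lift ord0)) => j /=.
by apply/seteqP; split=> x h j; have := h j; rewrite /I /= in_itv.
Qed.

Lemma ae_torus_itv (R : realType) d :
  \forall x \ae torus_measure R d, forall j, 0 <= tnth x j < 1.
Proof.
pose I := `[0, 1[%classic : set (measurableTypeR R).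
have mI : measurable I by exact: measurable_itv.
have E n : [set x : n.-tuple (measurableTypeR R) | forall j, 0 <= tnth x j < 1] =
    [set x | forall j, I (tnth x j)].
  by apply/seteqP; split=> x h j; have := h j; rewrite /I /= in_itv.
have mB n : measurable [set x : n.-tuple (measurableTypeR R) | forall j, I (tnth x j)].
  by apply: (measurable_box (I := fun=> I)) => j; exact: mI.
have : torus_measure R d [set x | forall j, I (tnth x j)] = 1%E.
  elim: d => [|d IH]; first by rewrite /= diracE mem_set // => -[].
  rewrite (torus_measure_boxS (I := fun=> I)) // IH mule1 uniform_prob_sub01 //.
    have -> := lebesgue_measure_itv `[(0:R), 1[.
    by rewrite /= lte_fin ltr01 oppr0 adde0.
  by move=> t; rewrite /I /= !in_itv /= => /andP[-> /ltW].
move=> m1; exists (~` [set x | forall j, I (tnth x j)]); split.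
- by apply: measurableC; exact: mB.
- by rewrite probability_setC ?m1 ?subee //; exact: mB.
- by apply: subsetC; rewrite -E.
Qed.
(** * Bounded limits of trigonometric polynomials *)

(** By dominated convergence, whatever is orthogonal to all characters is
    orthogonal to this class, and the class is large enough to contain the
    periodised indicator of every measurable set.  As an inductive predicate it
    gives both facts by induction on the construction of a function, and no
    explicit approximating kernel is needed. *)
Inductive trig_closure (R : realType) (d : nat) :
    (d.-tuple (measurableTypeR R) -> R) -> Prop :=
| trig_cos h : trig_closure (fun x => cos (2 * pi * dotx h x))
| trig_sin h : trig_closure (fun x => sin (2 * pi * dotx h x))
| trig_add f g : trig_closure f -> trig_closure g ->
    trig_closure (fun x => f x + g x)
| trig_scale a f : trig_closure f -> trig_closure (fun x => a * f x)
| trig_lim u f M : (forall n : nat, trig_closure (u n)) ->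
    (forall n x, `|u n x| <= M) ->
    (forall x, u n x @[n --> \oo] --> f x) -> trig_closure f.

Section TrigClosure.
Context (R : realType) (d : nat).
Local Notation pt := (d.-tuple (measurableTypeR R)).
Implicit Types (f g : pt -> R) (h k : d.-tuple int) (x : pt).

Lemma dotxD h k x :
  dotx [tuple tnth h j + tnth k j | j < d] x = dotx h x + dotx k x.
Proof.
rewrite /dotx -big_split; apply: eq_bigr => j _.
by rewrite tnth_mktuple intrD mulrDl.
Qed.

Lemma dotxN h x : dotx [tuple - tnth h j | j < d] x = - dotx h x.
Proof.
rewrite /dotx -sumrN; apply: eq_bigr => j _.
by rewrite tnth_mktuple intrN mulNr.
Qed.

Lemma dotx_unit (i : 'I_d) (x : pt) :
  dotx [tuple (j == i)%:Z | j < d] x = tnth x i.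
Proof.
rewrite /dotx (bigD1 i) //= big1 ?addr0.
  by rewrite tnth_mktuple eqxx mul1r.
by move=> j /negbTE ji; rewrite tnth_mktuple ji mul0r.
Qed.

Lemma trig_ext f g : f =1 g -> trig_closure f -> trig_closure g.
Proof. by move=> /funext ->. Qed.

Lemma trig_const a : trig_closure (fun=> a : R) (d := d).
Proof.
apply: trig_ext (trig_scale a (trig_cos R [tuple 0 | j < d])) => x.
rewrite /dotx big1 ?mulr0 ?cos0 ?mulr1 // => j _.
by rewrite tnth_mktuple mul0r.
Qed.

Lemma trig_opp f : trig_closure f -> trig_closure (fun x => - f x).
Proof. by move=> /(trig_scale (-1)); apply: trig_ext => x; rewrite mulN1r. Qed.

Lemma trig_bounded f : trig_closure f -> exists M, forall x, `|f x| <= M.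
Proof.
elim=> [h|h|{}f g _ [M hM] _ [N hN]|a {}f _ [M hM]|u {}f M _ _ uM uf].
- by exists 1 => x; exact: cos_max.
- by exists 1 => x; exact: sin_max.
- by exists (M + N) => x; rewrite (le_trans (ler_normD _ _)) // lerD.
- by exists (`|a| * M) => x; rewrite normrM ler_wpM2l.
- exists M => x; have /cvg_norm ufx := uf x.
  rewrite -(cvg_lim (@Rhausdorff R) ufx); apply: limr_le; first by apply/cvg_ex; exists `|f x|.
  by near=> n; exact: uM.
Unshelve. all: by end_near. Qed.

Lemma measurable_dotx h : measurable_fun setT (fun x : pt => dotx h x).
Proof.
rewrite /dotx; apply: measurable_sum => j.
by apply: measurable_funM => //; exact: measurable_tnth.
Qed.

Lemma trig_measurable f : trig_closure f -> measurable_fun setT f.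
Proof.
elim=> [h|h|{}f g _ mf _ mg|a {}f _ mf|u {}f M _ mu _ uf].
- apply: measurableT_comp; first exact: continuous_measurable_fun (@continuous_cos R).
  by apply: measurable_funM => //; exact: measurable_dotx.
- apply: measurableT_comp; first exact: continuous_measurable_fun (@continuous_sin R).
  by apply: measurable_funM => //; exact: measurable_dotx.
- exact: measurable_funD.
- exact: measurable_funM.
- exact: measurable_fun_cvg mu (fun x _ => uf x).
Qed.

(** Product-to-sum formulas settle the generators; the other constructors are
    compatible with multiplication by a fixed bounded function. *)
Lemma trig_mul_cos h f :
  trig_closure f -> trig_closure (fun x => cos (2 * pi * dotx h x) * f x) /\
                    trig_closure (fun x => sin (2 * pi * dotx h x) * f x).
Proof.
pose hD k := [tuple tnth h j + tnth k j | j < d].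
pose hB k := hD [tuple - tnth k j | j < d].
have ED k x : 2 * pi * dotx (hD k) x = 2 * pi * dotx h x + 2 * pi * dotx k x.
  by rewrite dotxD mulrDr.
have EB k x : 2 * pi * dotx (hB k) x = 2 * pi * dotx h x - 2 * pi * dotx k x.
  by rewrite dotxD dotxN mulrBr.
elim=> [k|k|{}f g _ [cf sf] _ [cg sg]|a {}f _ [cf sf]|u {}f M _ cu uM uf].
- split.
    apply: trig_ext (trig_scale 2^-1
      (trig_add (trig_cos _ (hD k)) (trig_cos _ (hB k)))) => x.
    by rewrite EB ED cosB cosD; lra.
  apply: trig_ext (trig_scale 2^-1
    (trig_add (trig_sin _ (hD k)) (trig_sin _ (hB k)))) => x.
  by rewrite EB ED sinB sinD; lra.
- split.
    apply: trig_ext (trig_scale 2^-1 (trig_add (trig_sin _ (hD k))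
      (trig_scale (-1) (trig_sin _ (hB k))))) => x.
    by rewrite EB ED sinB sinD; lra.
  apply: trig_ext (trig_scale 2^-1 (trig_add (trig_cos _ (hB k))
    (trig_scale (-1) (trig_cos _ (hD k))))) => x.
  by rewrite EB ED cosB cosD; lra.
- split.
    by apply: trig_ext (trig_add cf cg) => x; rewrite [RHS]mulrDr.
  by apply: trig_ext (trig_add sf sg) => x; rewrite [RHS]mulrDr.
- split.
    by apply: trig_ext (trig_scale a cf) => x; rewrite [RHS]mulrCA.
  by apply: trig_ext (trig_scale a sf) => x; rewrite [RHS]mulrCA.
- split.
    apply: (@trig_lim _ _ (fun n x => cos (2 * pi * dotx h x) * u n x) _ M).
    + by move=> n; case: (cu n).
    + by move=> n x; rewrite normrM -[M]mul1r ler_pM // cos_max.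
    + by move=> x; apply: cvgMr; exact: uf.
  apply: (@trig_lim _ _ (fun n x => sin (2 * pi * dotx h x) * u n x) _ M).
  + by move=> n; case: (cu n).
  + by move=> n x; rewrite normrM -[M]mul1r ler_pM // sin_max.
  + by move=> x; apply: cvgMr; exact: uf.
Qed.

(** The same induction, now on the first factor: the class is an algebra although
    no constructor mentions products. *)
Lemma trig_mul f g :
  trig_closure f -> trig_closure g -> trig_closure (fun x => f x * g x).
Proof.
move=> tf tg; elim: tf => [h|h|f1 f2 _ t1 _ t2|a f1 _ t1|u {}f M _ tu uM uf].
- by case: (trig_mul_cos h tg).
- by case: (trig_mul_cos h tg).
- by apply: trig_ext (trig_add t1 t2) => x; rewrite [RHS]mulrDl.
- by apply: trig_ext (trig_scale a t1) => x; rewrite mulrA.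
- have [N gN] := trig_bounded tg.
  apply: (@trig_lim _ _ (fun n x => u n x * g x) _ (M * N)) => //.
  + by move=> n x; rewrite normrM ler_pM.
  + by move=> x; apply: cvgMl; exact: uf.
Qed.

End TrigClosure.
(** * Indicators of measurable sets *)

(** The map fixes -1, 0 and 1 and moves every other point of [-1, 1]
    monotonically towards the fixed point of its own sign.  Since the iterates
    are polynomials, an algebra closed under bounded limits also contains the
    signs of its elements. *)
Lemma cvg_sg_iter (R : realType) (t : R) : `|t| <= 1 ->
  iter n (fun s => s * (3 - s ^+ 2) / 2) t @[n --> \oo] --> Num.sg t.
Proof.
pose phi (s : R) : R := s * (3 - s ^+ 2) / 2; rewrite -/phi.
have phiN s n : iter n phi (- s) = - iter n phi s.
  by elim: n => //= n ->; rewrite /phi sqrrN !mulNr.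
have pos s : 0 < s -> s <= 1 -> iter n phi s @[n --> \oo] --> (1 : R).
  move=> s0 s1.
  have up u : 0 < u -> u <= 1 -> u <= phi u <= 1.
    move=> u0 u1; have h1 : 0 <= u * ((1 - u) * (1 + u)).
      by rewrite !mulr_ge0 //; lra.
    have h2 : 0 <= (1 - u) ^+ 2 * (2 + u) by rewrite mulr_ge0 ?sqr_ge0 //; lra.
    by rewrite /phi; apply/andP; split; lra.
  have B n : s <= iter n phi s <= 1.
    elim: n => [|n /andP[h1 h2]]; first by rewrite lexx.
    have /andP[h3 ->] := up _ (lt_le_trans s0 h1) h2.
    by rewrite (le_trans h1 h3).
  have nd : nondecreasing_seq (fun n => iter n phi s).
    apply/nondecreasing_seqP => n; have /andP[h1 h2] := B n.
    by case/andP: (up _ (lt_le_trans s0 h1) h2).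
  have /cvg_ex[l hl] : cvgn (fun n => iter n phi s).
    by apply: nondecreasing_is_cvgn => //; exists 1 => _ [n _ <-]; case/andP: (B n).
  have hl1 : iter n.+1 phi s @[n --> \oo] --> l by have := hl; rewrite -cvg_shiftS.
  have hl2 : iter n.+1 phi s @[n --> \oo] --> phi l.
    have cphi : continuous phi.
      rewrite /phi => x; apply: cvgM; last exact: cvg_cst.
      apply: cvgM => //; apply: cvgB; first exact: cvg_cst.
      exact: exprn_continuous.
    exact: (continuous_cvg _ (cphi l) hl).
  have El := cvg_unique (@Rhausdorff R) hl1 hl2.
  have sl : s <= l.
    rewrite -(cvg_lim (@Rhausdorff R) hl); apply: limr_ge; first by apply/cvg_ex; exists l.
    by near=> n; case/andP: (B n).
  suff -> : 1 = l by [].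
  have : l * (l ^+ 2 - 1) = 0 
    by transitivity (2 * (l - phi l)); [rewrite /phi; field | rewrite -El subrr mulr0].
  move/eqP; rewrite mulf_eq0 subr_eq0 sqrf_eq1 => /or3P[/eqP|/eqP|/eqP]; lra.
move=> t1; have [t0|t0|<-] := ltgtP 0 t.
- by rewrite gtr0_sg //; apply: pos => //; rewrite -(gtr0_norm t0).
- rewrite ltr0_sg // -[t]opprK; under eq_fun do rewrite phiN.
  by apply: cvgN; apply: pos; rewrite ?oppr_gt0 // -(ltr0_norm t0).
- rewrite sgr0 (_ : (fun n => _) = fun=> 0); first exact: cvg_cst.
  by apply/funext; elim=> //= n ->; rewrite /phi !mul0r.
Unshelve. all: by end_near. Qed.
Lemma sin_2piDz (R : realType) (t : R) (k : int) :
  sin (2 * pi * (t + k%:~R)) = sin (2 * pi * t).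
Proof.
have E (s : R) (n : nat) : sin (s + pi *+ 2 *+ n) = sin s.
  exact: periodicn (@sinD2pi R) n s.
have Epi (n : nat) : 2 * pi * n%:R = pi *+ 2 *+ n :> R.
  by rewrite mulr_natl mulr_natr.
case: k => n.
  by rewrite mulrDr -[n%:~R]/(n%:R : R) Epi E.
rewrite NegzE mulrDr intrN mulrN -[(n.+1)%:~R]/(n.+1%:R : R) Epi.
by rewrite -[LHS](E _ n.+1) subrK.
Qed.

Lemma cos_2piDz (R : realType) (t : R) (k : int) :
  cos (2 * pi * (t + k%:~R)) = cos (2 * pi * t).
Proof.
rewrite -!sinDpihalf.
have E s : 2 * pi * s + pi / 2 = 2 * pi * (s + 4^-1) :> R by field.
rewrite !E.
have -> : t + k%:~R + 4^-1 = t + 4^-1 + k%:~R by ring.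
exact: sin_2piDz.
Qed.

(** The sign of the sine tells the two halves of a period apart, and the cosine is
    strictly monotone on each of them, so initial segments of the period are
    described by sine and cosine. *)
Lemma lt_half_trig (R : realType) (a t : R) :
  0 <= t < 1 -> 0 <= a <= 2^-1 ->
  (t < a) = (0 <= sin (2 * pi * t)) && (cos (2 * pi * a) < cos (2 * pi * t)).
Proof.
move=> /andP[t0 t1] /andP[a0 a1]; have pi0 := pi_gt0 R.
have [th|th] := leP t 2^-1.
  rewrite sin_ge0_pi ?ltr_cos ?in_itv /=; last first.
  - by apply/andP; split; nra.
  - by apply/andP; split; nra.
  - by apply/andP; split; nra.
  by rewrite ltr_pM2l ?mulr_gt0.
have -> : (0 <= sin (2 * pi * t)) = false.
  apply/negbTE; rewrite -ltNge.
  have -> : 2 * pi * t = (2 * pi * t - pi) + pi by ring.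
  rewrite sinDpi oppr_lt0; apply: sin_gt0_pi.
  by apply/andP; split; nra.
by apply/negbTE; rewrite -leNgt; lra.
Qed.

(** The complementary description, for cut points in the second half: there the
    reflection t |-> 1 - t brings both arguments into [0, pi], where the cosine
    decreases. *)
Lemma ge_half_trig (R : realType) (a t : R) :
  0 <= t < 1 -> 2^-1 < a <= 1 ->
  (a <= t) = (sin (2 * pi * t) < 0) && (cos (2 * pi * a) <= cos (2 * pi * t)).
Proof.
move=> /andP[t0 t1] /andP[a0 a1]; have pi0 := pi_gt0 R.
have [th|th] := leP t 2^-1.
  rewrite ltNge sin_ge0_pi /=; last by apply/andP; split; nra.
  by apply/negbTE; rewrite -ltNge; lra.
have -> : sin (2 * pi * t) < 0.
  have -> : 2 * pi * t = (2 * pi * t - pi) + pi by ring.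
  rewrite sinDpi oppr_lt0; apply: sin_gt0_pi.
  by apply/andP; split; nra.
have E s : cos (2 * pi * s) = cos (2 * pi * (1 - s)) :> R.
  have -> : 1 - s = - s + 1%:~R by ring.
  by rewrite cos_2piDz mulrN cosN.
rewrite /= (E a) (E t) !leNgt ltr_cos ?in_itv /=; last 2 first.
- by apply/andP; split; nra.
- by apply/andP; split; nra.
by rewrite ltr_pM2l ?mulr_gt0 // ltrD2l ltrN2.
Qed.
Section TrigIndicator.
Context (R : realType) (d : nat).
Local Notation pt := (d.-tuple (measurableTypeR R)).
Implicit Types (f g : pt -> R) (x : pt) (A : set pt).

Lemma trig_sg f : trig_closure f -> trig_closure (fun x => Num.sg (f x)).
Proof.
move=> tf; have [M fM] := trig_bounded tf.
pose c := (Num.max M 1)^-1.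
have M0 : 0 < Num.max M 1 :> R by rewrite lt_max ltr01 orbT.
have c0 : 0 < c by rewrite invr_gt0.
pose u n x := iter n (fun s => s * (3 - s ^+ 2) / 2) (c * f x).
have cf1 x : `|c * f x| <= 1.
  rewrite normrM gtr0_norm // mulrC ler_pdivrMr // mul1r.
  by rewrite (le_trans (fM x)) // le_max lexx.
have u1 n x : `|u n x| <= 1.
  elim: n => [|n IH]; first exact: cf1.
  rewrite /u iterS -/(u n x); set s := u n x in IH *.
  have h1 : 0 <= (1 - s) ^+ 2 * (2 + s).
    by rewrite mulr_ge0 ?sqr_ge0 //; move: IH; rewrite ler_norml; lra.
  have h2 : 0 <= (1 + s) ^+ 2 * (2 - s).
    by rewrite mulr_ge0 ?sqr_ge0 //; move: IH; rewrite ler_norml; lra.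
  by rewrite ler_norml; apply/andP; split; lra.
apply: (@trig_lim _ _ u _ 1) => // [n|x].
  elim: n => [|n IH]; first exact: trig_scale.
  have t2 : trig_closure (fun x => 3 + (-1) * (u n x * u n x)).
    apply: trig_add; first exact: trig_const.
    by apply: trig_scale; exact: trig_mul.
  apply: trig_ext (trig_scale 2^-1 (trig_mul IH t2)) => x.
  by rewrite /u iterS -/(u n x) mulN1r [RHS]mulrC expr2.
have -> : Num.sg (f x) = Num.sg (c * f x) by rewrite sgrM (gtr0_sg c0) mul1r.
exact: cvg_sg_iter.
Qed.

Lemma trig_pos f : trig_closure f -> trig_closure (fun x => (0 < f x)%R%:R).
Proof.
move=> /trig_sg tf.
apply: trig_ext (trig_scale 2^-1 (trig_add (trig_mul tf tf) tf)) => x.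
have [h|h|<-] := ltgtP 0 (f x).
- by rewrite gtr0_sg //=; lra.
- by rewrite ltr0_sg //=; lra.
- by rewrite sgr0 /=; lra.
Qed.

Lemma trig_nonneg f : trig_closure f -> trig_closure (fun x => (0 <= f x)%R%:R).
Proof.
move=> /trig_opp/trig_pos/trig_opp tf.
apply: trig_ext (trig_add (trig_const d 1) tf) => x.
by rewrite oppr_gt0 leNgt; case: ltP => _; rewrite ?subrr ?subr0.
Qed.

(** Members of the class are periodic, so a set is represented through its
    intersection with the fundamental cube. *)
Definition trig_set A := trig_closure (fun x => \1_A (mod1 x) : R).

Lemma trig_setC A : trig_set A -> trig_set (~` A).
Proof.
move=> /trig_opp tA; apply: trig_ext (trig_add (trig_const d 1) tA) => x.
rewrite !indicE in_setC; case: (mod1 x \in A) => /=; lra.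
Qed.

Lemma trig_setI A B : trig_set A -> trig_set B -> trig_set (A `&` B).
Proof.
move=> tA tB; apply: trig_ext (trig_mul tA tB) => x.
rewrite !indicE in_setI; by case: (_ \in A); case: (_ \in B) => /=; lra.
Qed.

(** At every point the indicators of the finite unions are eventually constant. *)
Lemma trig_set_bigcup (F : (set pt)^nat) :
  (forall n, trig_set (F n)) -> trig_set (\bigcup_n F n).
Proof.
move=> tF; pose G n := \big[setU/set0]_(k < n) F k.
have tG n : trig_set (G n).
  rewrite /G; elim: n => [|n IH].
    rewrite big_ord0; apply: trig_ext (trig_const d 0) => x.
    by rewrite indicE in_set0.
  rewrite big_ord_recr /= -[_ `|` _]setCK setCU.
  by apply: trig_setC; apply: trig_setI; exact: trig_setC.
apply: (@trig_lim _ _ (fun n x => \1_(G n) (mod1 x)) _ 1) => // [n x|x].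
  by rewrite indicE; case: (_ \in _); rewrite ?normr1 ?normr0.
apply: cvg_near_cst.
have [[k _ Fk]|nF] := pselect ((\bigcup_n F n) (mod1 x)).
  exists k.+1 => // n /= kn; rewrite !indicE !mem_set //; first by exists k.
  by rewrite /G -bigcup_mkord; exists k.
apply: nearW => n; rewrite !indicE !memNset // /G -bigcup_mkord => -[k _ Fk].
by apply: nF; exists k.
Qed.

Lemma sigma_algebra_trig_set : sigma_algebra setT trig_set.
Proof.
split=> [|A tA|F tF].
- apply: trig_ext (trig_const d 0) => x; by rewrite indicE in_set0.
- by rewrite setTD; exact: trig_setC.
- exact: trig_set_bigcup.
Qed.

Lemma mod1_itv x (j : 'I_d) : 0 <= tnth (mod1 x) j < 1.
Proof.
rewrite tnth_mktuple; have /andP[h1 h2] := floor_itv (tnth x j).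
by move: h2; rewrite intrD => h2; apply/andP; split; lra.
Qed.

Lemma trig_set_coord (j : 'I_d) (a : R) : trig_set [set x | tnth x j < a].
Proof.
have [a0|a0] := leP a 0.
  apply: trig_ext (trig_const d 0) => x.
  rewrite indicE memNset // => /= /lt_geF.
  by have /andP[h _] := mod1_itv x j; rewrite (le_trans a0).
have [a1|a1] := ltP 1 a.
  apply: trig_ext (trig_const d 1) => x.
  by rewrite indicE mem_set //=; have /andP[_ h] := mod1_itv x j; exact: lt_trans h a1.
pose e := [tuple (i == j)%:Z | i < d].
have S x : sin (2 * pi * dotx e x) = sin (2 * pi * tnth (mod1 x) j).
  rewrite dotx_unit -(sin_2piDz (tnth (mod1 x) j) (Num.floor (tnth x j))).
  by rewrite tnth_mktuple subrK.
have C x : cos (2 * pi * dotx e x) = cos (2 * pi * tnth (mod1 x) j).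
  rewrite dotx_unit -(cos_2piDz (tnth (mod1 x) j) (Num.floor (tnth x j))).
  by rewrite tnth_mktuple subrK.
have tc (s : R) : trig_closure (fun x => cos (2 * pi * dotx e x) + s).
  by apply: trig_add; [exact: trig_cos | exact: trig_const].
have [ah|ah] := leP a 2^-1.
  apply: trig_ext (trig_mul (trig_nonneg (trig_sin R e))
    (trig_pos (tc (- cos (2 * pi * a))))) => x.
  rewrite indicE S C subr_gt0 -natrM mulnb -lt_half_trig ?mod1_itv ?(ltW a0) //.
  by congr (nat_of_bool _)%:R; apply/idP/idP => [h|]; rewrite ?inE.
rewrite -[X in trig_set X]setCK; apply: trig_setC.
apply: trig_ext (trig_mul (trig_pos (trig_opp (trig_sin R e)))
  (trig_nonneg (tc (- cos (2 * pi * a))))) => x.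
rewrite indicE S C subr_ge0 oppr_gt0 -natrM mulnb -ge_half_trig ?mod1_itv ?ah //.
congr (nat_of_bool _)%:R; rewrite leNgt in_setC; congr (~~ _).
by apply/idP/idP => [h|]; rewrite ?inE.
Qed.

(** The sets with a good indicator form a sigma-algebra that contains the
    half-spaces in each coordinate direction. *)
Lemma measurable_trig_set A : measurable A -> trig_set A.
Proof.
apply: (smallest_sub sigma_algebra_trig_set).
move=> B; rewrite -bigcup_seq => -[j _ [Y mY <-]]; rewrite setTI.
suff: measurable `<=` [set Y | trig_set ((fun x : pt => tnth x j) @^-1` Y)] by exact.
rewrite [X in X `<=` _](RGenInftyO.measurableE R); apply: smallest_sub.
  split=> [|Z tZ|F tF] /=.
  - by rewrite preimage_set0; case: sigma_algebra_trig_set.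
  - by rewrite setTD preimage_setC; exact: trig_setC.
  - by rewrite preimage_bigcup; exact: trig_set_bigcup.
move=> Z [a ->] /=; have := trig_set_coord j a.
by congr (trig_set _); apply/seteqP; split=> x /=; rewrite in_itv.
Qed.

End TrigIndicator.
(** * Uniqueness of Fourier coefficients *)

Section FourierUniqueness.
Context (R : realType) (d : nat).
Local Notation pt := (d.-tuple (measurableTypeR R)).
Local Notation mu := (torus_measure R d).
Implicit Types (u f g : pt -> R) (x : pt) (A : set pt).

Lemma integrable_mul_bounded u f M : mu.-integrable setT (EFin \o u) ->
  measurable_fun setT f -> (forall x, `|f x| <= M) ->
  mu.-integrable setT (EFin \o (fun x => u x * f x)).
Proof.
move=> iu mf fM; apply: (le_integrable _ _ _ (integrableZl measurableT M iu)) => //.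
  apply/measurable_EFinP; apply: measurable_funM => //.
  by have /measurable_int/measurable_EFinP := iu.
move=> x _ /=; rewrite lee_fin !normrM mulrC.
by rewrite ler_wpM2r // (le_trans (fM x)) // ler_norm.
Qed.

Lemma trig_Rintegral_eq0 u : mu.-integrable setT (EFin \o u) ->
  (forall h, \int[mu]_x (u x * cos (2 * pi * dotx h x)) = 0) ->
  (forall h, \int[mu]_x (u x * sin (2 * pi * dotx h x)) = 0) ->
  forall f, trig_closure f -> \int[mu]_x (u x * f x) = 0.
Proof.
move=> iu u_cos u_sin f.
have I g : trig_closure g -> mu.-integrable setT (EFin \o (fun x => u x * g x)).
  move=> tg; have [M gM] := trig_bounded tg.
  by apply: integrable_mul_bounded gM => //; exact: trig_measurable.
elim=> {f} [h|h|f g tf IHf tg IHg|a f tf IHf|v f M tv IHv vM vf] //.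
- under eq_Rintegral do rewrite mulrDr.
  by rewrite RintegralD ?IHf ?IHg ?addr0 //; exact: I.
- under eq_Rintegral do rewrite mulrCA.
  by rewrite RintegralZl ?IHf ?mulr0 //; exact: I.
- have tf : trig_closure f by exact: trig_lim vM vf.
  have iM : mu.-integrable setT (fun x => M%:E * (EFin \o u) x)%E by exact: integrableZl.
  have [] := @dominated_convergence _ _ _ mu setT measurableT
     (fun n x => (u x * v n x)%:E) (fun x => (u x * f x)%:E)
     (fun x => `|M%:E * (EFin \o u) x|%E).
  + by move=> n; have /measurable_int := I _ (tv n).
  + by have /measurable_int := I _ tf.
  + apply: nearW => x _; apply: cvg_EFin; first by apply: nearW.
    by apply: cvgMr; exact: vf.
  + exact: integrable_abse.
  + apply: nearW => x n _ /=; rewrite lee_fin !normrM mulrC.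
    by rewrite ler_wpM2r // (le_trans (vM n x)) // ler_norm.
  move=> _ _ /=; rewrite (_ : (fun n => _) = fun=> 0%E); last first.
    apply/funext => n; rewrite -[LHS]fineK; first by congr EFin; exact: IHv.
    by apply: integrable_fin_num => //; exact: I.
  move=> c0; have := cvg_unique (@ereal_hausdorff R) c0 (cvg_cst _).
  by rewrite /Rintegral => ->.
Qed.

Lemma torus_aeS (P Q : set pt) : P `<=` Q ->
  (\forall x \ae mu, P x) -> \forall x \ae mu, Q x.
Proof. by move=> PQ; apply: filterS. Qed.

Lemma mod1_id x : (forall j, 0 <= tnth x j < 1) -> mod1 x = x.
Proof.
move=> x01; apply: eq_from_tnth => j.
rewrite tnth_mktuple (_ : Num.floor _ = 0) ?subr0 //.
by apply/eqP; rewrite floor_eq add0r; exact: x01.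
Qed.

Lemma ae_mod1 : \forall x \ae mu, mod1 x = x.
Proof. by apply: torus_aeS (ae_torus_itv R d) => x; exact: mod1_id. Qed.

(** Testing against periodised indicators shows that the integral of u over every
    measurable set is zero. *)
Lemma fourier_uniqueness_real u : mu.-integrable setT (EFin \o u) ->
  (forall h, \int[mu]_x (u x * cos (2 * pi * dotx h x)) = 0) ->
  (forall h, \int[mu]_x (u x * sin (2 * pi * dotx h x)) = 0) ->
  \forall x \ae mu, u x = 0.
Proof.
move=> iu u_cos u_sin.
have : ae_eq mu setT (EFin \o u) (cst 0%E).
  apply: integral_ae_eq => // E _ mE.
  rewrite integral0 integral_mkcond.
  have tE := measurable_trig_set mE.
  transitivity (\int[mu]_x (u x * \1_E (mod1 x))%:E)%E; last first.
    rewrite -[LHS]fineK; first by congr EFin; exact: trig_Rintegral_eq0 tE.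
    apply: integrable_fin_num => //.
    have [M gM] := trig_bounded tE.
    by apply: integrable_mul_bounded gM => //; exact: trig_measurable.
  apply: ae_eq_integral => //.
  - have /measurable_int mu_ := iu.
    by apply/(measurable_restrictT _ mE); exact: measurable_funS mu_.
  - apply/measurable_EFinP/measurable_funM.
      by have /measurable_int/measurable_EFinP := iu.
    exact: trig_measurable.
  - apply: torus_aeS ae_mod1 => x E1 _; rewrite patchE /= E1 indicE.
    by case: (x \in E); rewrite ?mulr1 ?mulr0.
by apply: torus_aeS => x /(_ I) /= [].
Qed.

Definition cos_coef u h := \int[mu]_x (u x * cos (2 * pi * dotx h x)).
Definition sin_coef u h := \int[mu]_x (u x * sin (2 * pi * dotx h x)).

Lemma integrable_mul_trig u f : mu.-integrable setT (EFin \o u) ->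
  trig_closure f -> mu.-integrable setT (EFin \o (fun x => u x * f x)).
Proof.
move=> iu tf; have [M fM] := trig_bounded tf.
by apply: integrable_mul_bounded fM => //; exact: trig_measurable.
Qed.

(** Together with the parity in h, this recovers the four real coefficients of f
    from its complex coefficients at h and -h, and so reduces uniqueness to
    real functions. *)
Lemma fourier_coefE (f : pt -> R[i]) h : L1_torus f ->
  fourier_coef f h =
  ((cos_coef (fun x => complex.Re (f x)) h + sin_coef (fun x => complex.Im (f x)) h) +i*
   (cos_coef (fun x => complex.Im (f x)) h - sin_coef (fun x => complex.Re (f x)) h))%C.
Proof.
move=> [iR iI]; rewrite /fourier_coef /integral_torus /cos_coef /sin_coef.
have tc := trig_cos R h; have ts := trig_sin R h.
congr (_ +i* _)%C.
  rewrite -RintegralD //; [|exact: integrable_mul_trig..].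
  apply: eq_Rintegral => x _; case: (f x) => a b /=.
  by rewrite mulrN sinN cosN mulrN opprK.
rewrite -RintegralB //; [|exact: integrable_mul_trig..].
apply: eq_Rintegral => x _; case: (f x) => a b /=.
by rewrite mulrN sinN cosN mulrN addrC.
Qed.

Lemma cos_coefN u h : cos_coef u [tuple - tnth h j | j < d] = cos_coef u h.
Proof. by apply: eq_Rintegral => x _; rewrite dotxN mulrN cosN. Qed.

Lemma sin_coefN u h : mu.-integrable setT (EFin \o u) ->
  sin_coef u [tuple - tnth h j | j < d] = - sin_coef u h.
Proof.
move=> iu; rewrite -mulN1r -RintegralZl //; last first.
  by apply: integrable_mul_trig => //; exact: trig_sin.
by apply: eq_Rintegral => x _; rewrite dotxN mulrN sinN mulrN mulN1r.
Qed.

Lemma fourier_uniqueness (f g : pt -> R[i]) : L1_torus f -> L1_torus g ->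
  (forall h, fourier_coef f h = fourier_coef g h) ->
  \forall x \ae mu, f x = g x.
Proof.
move=> Lf Lg fg; have [fR fI] := Lf; have [gR gI] := Lg.
pose fr x := complex.Re (f x); pose fi x := complex.Im (f x).
pose gr x := complex.Re (g x); pose gi x := complex.Im (g x).
have E h : [/\ cos_coef fr h = cos_coef gr h, cos_coef fi h = cos_coef gi h,
    sin_coef fr h = sin_coef gr h & sin_coef fi h = sin_coef gi h].
  have := fg h; have := fg [tuple - tnth h j | j < d].
  rewrite !fourier_coefE // -/fr -/fi -/gr -/gi.
  rewrite !cos_coefN !sin_coefN // => -[e1 e2] [e3 e4].
  by split; lra.
have U (u v : pt -> R) : mu.-integrable setT (EFin \o u) ->
    mu.-integrable setT (EFin \o v) -> cos_coef u =1 cos_coef v ->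
    sin_coef u =1 sin_coef v -> \forall x \ae mu, u x - v x = 0.
  move=> iu iv cuv suv; apply: fourier_uniqueness_real.
  - by rewrite (_ : _ \o _ = (fun x => (EFin \o u) x - (EFin \o v) x)%E) //; exact: integrableB.
  - move=> h; under eq_Rintegral do rewrite mulrBl.
    rewrite RintegralB //; [|by apply: integrable_mul_trig => //; exact: trig_cos..].
    by rewrite -/(cos_coef u h) -/(cos_coef v h) cuv subrr.
  - move=> h; under eq_Rintegral do rewrite mulrBl.
    rewrite RintegralB //; [|by apply: integrable_mul_trig => //; exact: trig_sin..].
    by rewrite -/(sin_coef u h) -/(sin_coef v h) suv subrr.
have UR := U _ _ fR gR (fun h => let: And4 e _ _ _ := E h in e)
                       (fun h => let: And4 _ _ e _ := E h in e).
have UI := U _ _ fI gI (fun h => let: And4 _ e _ _ := E h in e)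
                       (fun h => let: And4 _ _ _ e := E h in e).
apply: (torus_aeS _ (filterI UR UI)) => x [/eqP + /eqP].
rewrite !subr_eq0 => /eqP + /eqP.
by case: (f x) (g x) => a b [a' b'] /= -> ->.
Qed.

End FourierUniqueness.
(** * Orthogonality of the characters *)

Lemma integrable_bounded (R : realType) d (T : measurableType d)
    (P : probability T R) (f : T -> R) M :
  measurable_fun setT f -> (forall x, `|f x| <= M) ->
  P.-integrable setT (EFin \o f).
Proof.
move=> mf fM; apply: (@le_integrable _ _ _ P setT measurableT _ (EFin \o cst M)).
- exact/measurable_EFinP.
- by move=> x _ /=; rewrite lee_fin (le_trans (fM x)) // ler_norm.
- exact: finite_measure_integrable_cst.
Qed.

Lemma Rintegral_cst_probability (R : realType) d (T : measurableType d)
    (P : probability T R) (r : R) : \int[P]_x r = r.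
Proof.
rewrite Rintegral_cst // -[RHS]mulr1; congr (_ * _).
transitivity (fine (1%E : \bar R)) => //; congr fine.
exact: probability_setT P.
Qed.

Lemma uniform_Rintegral_derive (R : realType) (F f : R -> R) :
  (forall t : R, is_derive t (1 : R) F (f t)) -> continuous f -> (forall t, 0 <= f t) ->
  \int[uniform_prob (@ltr01 R)]_t f t = F 1 - F 0.
Proof.
move=> dF cf f0; rewrite /Rintegral integral_uniform //; last first.
  by apply/measurable_EFinP; exact: continuous_measurable_fun.
have cF : continuous F.
  by move=> t; apply/differentiable_continuous/derivable1_diffP; apply: ex_derive.
rewrite (@continuous_FTC2 _ f F) ?ltr01 //.
- by rewrite subr0 invr1 mul1e -EFinB.
- exact: continuous_subspaceT.
- split.
  + by move=> x _; apply: ex_derive.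
  + by apply: cvg_at_right_filter; exact: cF.
  + by apply: cvg_at_left_filter; exact: cF.
- by move=> x _; rewrite derive1E; exact: derive_val.
Qed.

Lemma uniform_Rintegral_trig (R : realType) (k : int) : k != 0 ->
  \int[uniform_prob (@ltr01 R)]_t cos (2 * pi * (k%:~R * t)) = 0 /\
  \int[uniform_prob (@ltr01 R)]_t sin (2 * pi * (k%:~R * t)) = 0.
Proof.
move=> k0; pose w : R := 2 * pi * k%:~R.
have w0 : w != 0.
  by rewrite /w !mulf_neq0 ?intr_eq0 // ?pnatr_eq0 // gt_eqF // pi_gt0.
have Ew t : 2 * pi * (k%:~R * t) = w * t by rewrite mulrA.
under eq_Rintegral do rewrite Ew; under [X in _ /\ X = _]eq_Rintegral do rewrite Ew.
have cw : continuous (fun t : R => w * t) by move=> t; apply: cvgMr; exact: cvg_id.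
have ccos : continuous (fun t : R => cos (w * t)).
  by move=> t; apply: continuous_comp; [exact: cw | exact: continuous_cos].
have csin : continuous (fun t : R => sin (w * t)).
  by move=> t; apply: continuous_comp; [exact: cw | exact: continuous_sin].
have dw t : is_derive t (1 : R) (fun t : R => w * t) w.
  by apply: is_derive_eq; rewrite /GRing.scale /= mulr1.
have w1 : sin w = 0 /\ cos w = 1.
  rewrite /w -[k%:~R]add0r sin_2piDz cos_2piDz mulr0 sin0 cos0 //.
(* The uniform law turns into Lebesgue measure on nonnegative integrands, hence
   the shift by 1. *)
have one (g : R -> R) : continuous g -> (forall t, `|g t| <= 1) ->
    \int[uniform_prob (@ltr01 R)]_t (1 + g t) = 1 ->
    \int[uniform_prob (@ltr01 R)]_t g t = 0.
  move=> cg g1; rewrite RintegralD //.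
  - have U1 := Rintegral_cst_probability (uniform_prob (@ltr01 R)) 1.
    by rewrite [X in X + _]U1; lra.
  - exact: finite_measure_integrable_cst.
  - apply: (@integrable_bounded _ _ _ (uniform_prob (@ltr01 R)) g 1) => //.
    exact: continuous_measurable_fun.
split; apply: one => //.
- by move=> t; exact: cos_max.
- have dF (t : R) : is_derive t (1 : R) (fun t => t + sin (w * t) / w) (1 + cos (w * t)).
    have dsin := is_derive1_comp (is_derive_sin (w * t)) (dw t).
    apply: is_derive_eq.
    by rewrite /GRing.scale /=; field.
  rewrite (uniform_Rintegral_derive dF).
  + by rewrite mulr1 mulr0 w1.1 sin0 !mul0r !addr0 subr0.
  + by move=> t; apply: cvgD; [exact: cvg_cst | exact: ccos].
  + by move=> t; have := cos_geN1 (w * t); lra.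
- by move=> t; exact: sin_max.
- have dF (t : R) : is_derive t (1 : R) (fun t => t - cos (w * t) / w) (1 + sin (w * t)).
    have dcos := is_derive1_comp (is_derive_cos (w * t)) (dw t).
    apply: is_derive_eq.
    by rewrite /GRing.scale /=; field.
  rewrite (uniform_Rintegral_derive dF).
  + by rewrite mulr1 mulr0 w1.2 cos0; ring.
  + by move=> t; apply: cvgD; [exact: cvg_cst | exact: csin].
  + by move=> t; have := sin_geN1 (w * t); lra.
Qed.

Section ProductRintegral.
Context (R : realType) d1 d2 (T1 : measurableType d1) (T2 : measurableType d2).
Variables (P1 : probability T1 R) (P2 : probability T2 R).

Lemma Rintegral_prodM (f : T1 -> R) (g : T2 -> R) :
  measurable_fun setT f -> measurable_fun setT g ->
  (forall x, `|f x| <= 1) -> (forall y, `|g y| <= 1) ->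
  \int[(P1 \x P2)%E]_z (f z.1 * g z.2) = \int[P1]_x f x * \int[P2]_y g y.
Proof.
move=> mf mg f1 g1.
have mF : measurable_fun setT (fun z : T1 * T2 => f z.1 * g z.2).
  by apply: measurable_funM; exact: measurableT_comp.
have F1 (z : T1 * T2) : `|f z.1 * g z.2| <= 1.
  by rewrite normrM -[1]mulr1 ler_pM.
have iF := @integrable_bounded _ _ _ (P1 \x P2)%E _ 1 mF F1.
have ig := @integrable_bounded _ _ _ P2 _ 1 mg g1.
have if_ := @integrable_bounded _ _ _ P1 _ 1 mf f1.
rewrite {1}/Rintegral -(integral12_prod_meas1 iF) /fubini_F /=.
rewrite -RintegralZr // /Rintegral; congr fine; apply: eq_integral => x _.
rewrite [RHS]EFinM fineK ?integrable_fin_num //.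
rewrite /=; under eq_integral do rewrite EFinM.
by rewrite integralZl.
Qed.
End ProductRintegral.

Lemma dotx_cons (R : realType) n (h : n.+1.-tuple int) (t : R) (x : n.-tuple R) :
  dotx h [tuple of t :: x] =
  (tnth h ord0)%:~R * t + dotx [tuple tnth h (lift ord0 j) | j < n] x.
Proof.
rewrite /dotx big_ord_recl tnth0; congr (_ + _).
by apply: eq_bigr => j _; rewrite tnthS tnth_mktuple.
Qed.

(** Induction on the dimension: the addition formulas split off the first
    coordinate and Fubini's theorem factors the integral.  Either the first
    frequency is nonzero and the one-dimensional integrals vanish, or the
    remaining frequencies satisfy the induction hypothesis. *)
Lemma torus_Rintegral_trig (R : realType) d (h : d.-tuple int) :
  (exists j, tnth h j != 0) ->
  \int[torus_measure R d]_x cos (2 * pi * dotx h x) = 0 /\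
  \int[torus_measure R d]_x sin (2 * pi * dotx h x) = 0.
Proof.
elim: d h => [h [[]] //|n IH h hj].
pose k := [tuple tnth h (lift ord0 j) | j < n].
pose a : R := (tnth h ord0)%:~R.
pose U := uniform_prob (@ltr01 R).
have push (f : n.+1.-tuple (measurableTypeR R) -> R) : measurable_fun setT f ->
    (forall x, `|f x| <= 1) -> \int[torus_measure R n.+1]_x f x =
    \int[(U \x torus_measure R n)%E]_z f (tuple_cons z).
  move=> mf f1; rewrite /Rintegral; congr fine.
  rewrite [LHS](@integral_pushforward _ _ _ _ _ (@tuple_cons R n)) //.
  - exact/measurable_EFinP.
  - have mf' : measurable_fun setT (f \o @tuple_cons R n).
      by apply: measurableT_comp => //; exact: measurable_tuple_cons.
    exact: (@integrable_bounded _ _ _ (U \x torus_measure R n)%E _ 1 mf' (fun z => f1 _)).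
have mcos c : measurable_fun setT (fun t : R => cos (2 * pi * (c * t))).
  apply: continuous_measurable_fun => t; apply: continuous_comp; last exact: continuous_cos.
  by apply: cvgMr; apply: cvgMr; exact: cvg_id.
have msin c : measurable_fun setT (fun t : R => sin (2 * pi * (c * t))).
  apply: continuous_measurable_fun => t; apply: continuous_comp; last exact: continuous_sin.
  by apply: cvgMr; apply: cvgMr; exact: cvg_id.
pose ca t : R := cos (2 * pi * (a * t)); pose sa t : R := sin (2 * pi * (a * t)).
pose ck (x : n.-tuple (measurableTypeR R)) := cos (2 * pi * dotx k x).
pose sk (x : n.-tuple (measurableTypeR R)) := sin (2 * pi * dotx k x).
have mck : measurable_fun setT ck by exact: trig_measurable (trig_cos R k).
have msk : measurable_fun setT sk by exact: trig_measurable (trig_sin R k).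
have E1 z : cos (2 * pi * dotx h (tuple_cons z)) = ca z.1 * ck z.2 - sa z.1 * sk z.2.
  by rewrite dotx_cons mulrDr cosD.
have E2 z : sin (2 * pi * dotx h (tuple_cons z)) = sa z.1 * ck z.2 + ca z.1 * sk z.2.
  by rewrite dotx_cons mulrDr sinD.
have bc (t : R) : `|cos t| <= 1 by exact: cos_max.
have bs (t : R) : `|sin t| <= 1 by exact: sin_max.
rewrite !push //; [|exact: trig_measurable (trig_sin R h)
                   |exact: trig_measurable (trig_cos R h)].
under eq_Rintegral do rewrite E1; under [X in _ /\ X = _]eq_Rintegral do rewrite E2.
have I (f : R -> R) (g : n.-tuple (measurableTypeR R) -> R) :
    measurable_fun setT f -> measurable_fun setT g ->
    (forall x, `|f x| <= 1) -> (forall y, `|g y| <= 1) ->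
    (U \x torus_measure R n)%E.-integrable setT (EFin \o (fun z => f z.1 * g z.2)).
  move=> mf mg f1 g1.
  have mF : measurable_fun setT
      (fun z : measurableTypeR R * n.-tuple (measurableTypeR R) => f z.1 * g z.2).
    by apply: measurable_funM; exact: measurableT_comp.
  apply: (@integrable_bounded _ _ _ (U \x torus_measure R n)%E _ 1 mF) => z.
  by rewrite normrM -[1]mulr1 ler_pM ?f1 ?g1.
have mca := mcos a; have msa := msin a.
rewrite RintegralB ?RintegralD //; [|by apply: I => // x; rewrite ?bc ?bs..].
rewrite !(Rintegral_prodM (uniform_prob (@ltr01 R)) (torus_measure R n)) //;
  try by move=> x; rewrite ?bc ?bs.
have [a0|a0] := eqVneq (tnth h ord0) 0; last first.
  have [ica isa] := uniform_Rintegral_trig R a0.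
  by rewrite /ca /sa ica isa !mul0r subr0 addr0.
have [] : (\int[torus_measure R n]_y ck y = 0 /\ \int[torus_measure R n]_y sk y = 0).
  apply: IH; case: hj => j; case: (unliftP ord0 j) => [i ->|->]; last by rewrite a0.
  by exists i; rewrite tnth_mktuple.
by move=> -> ->; rewrite !mulr0 subr0 addr0.
Qed.
(** * Complex exponentials and trigonometric polynomials *)

Section ComplexExponential.
Variable R : realType.
Local Notation C := R[i].
Implicit Types (s t : R) (z w : C).

Lemma ReD z w : complex.Re (z + w) = complex.Re z + complex.Re w.
Proof. by case: z w => a b [c e]. Qed.

Lemma ImD z w : complex.Im (z + w) = complex.Im z + complex.Im w.
Proof. by case: z w => a b [c e]. Qed.

Lemma ReB z w : complex.Re (z - w) = complex.Re z - complex.Re w.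
Proof. by case: z w => a b [c e]. Qed.

Lemma ImB z w : complex.Im (z - w) = complex.Im z - complex.Im w.
Proof. by case: z w => a b [c e]. Qed.

Lemma Re_sum (I : Type) (r : seq I) (F : I -> C) :
  complex.Re (\sum_(i <- r) F i) = \sum_(i <- r) complex.Re (F i).
Proof. by apply: (big_morph (@complex.Re R)) => //; exact: ReD. Qed.

Lemma Im_sum (I : Type) (r : seq I) (F : I -> C) :
  complex.Im (\sum_(i <- r) F i) = \sum_(i <- r) complex.Im (F i).
Proof. by apply: (big_morph (@complex.Im R)) => //; exact: ImD. Qed.

Lemma normc_ge0 z : 0 <= Normc.normc z.
Proof. by case: z => a b; exact: sqrtr_ge0. Qed.

Lemma ler_Re_normc z : `|complex.Re z| <= Normc.normc z.
Proof. by case: z => a b /=; rewrite -sqrtr_sqr ler_wsqrtr // lerDl sqr_ge0. Qed.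

Lemma ler_Im_normc z : `|complex.Im z| <= Normc.normc z.
Proof. by case: z => a b /=; rewrite -sqrtr_sqr ler_wsqrtr // lerDr sqr_ge0. Qed.

Lemma ler_normc_ReIm z : Normc.normc z <= `|complex.Re z| + `|complex.Im z|.
Proof.
case: z => a b /=; have h : 0 <= `|a| + `|b| by rewrite addr_ge0.
rewrite -[leRHS]ger0_norm // -sqrtr_sqr ler_wsqrtr //.
rewrite -(real_normK (num_real a)) -(real_normK (num_real b)).
have : 0 <= `|a| * `|b| by rewrite mulr_ge0.
by rewrite sqrrD; lra.
Qed.

Lemma ler_normc_sum (I : Type) (r : seq I) (F : I -> C) :
  Normc.normc (\sum_(i <- r) F i) <= \sum_(i <- r) Normc.normc (F i).
Proof.
elim/big_ind2: _ => [|z x w y zx wy|//]; first by rewrite Normc.normc0.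
by rewrite (le_trans (le_normcD _ _)) // lerD.
Qed.

Lemma normc_nat n : Normc.normc (n%:R : C) = n%:R.
Proof.
rewrite (_ : n%:R = (n%:R +i* 0)%C) /=.
  by rewrite expr0n addr0 sqrtr_sqr ger0_norm.
by elim: n => // n IH; rewrite -!natr1 IH; congr (_ +i* _)%C; rewrite addr0.
Qed.

Lemma expi0 : expi 0 = 1 :> C.
Proof. by rewrite /expi mulr0 cos0 sin0. Qed.

Lemma expiD s t : expi (s + t) = expi s * expi t.
Proof.
rewrite /expi mulrDr cosD sinD; congr (_ +i* _)%C.
by rewrite addrC [cos _ * sin _]mulrC addrC.
Qed.

Lemma expiDz t (k : int) : expi (t + k%:~R) = expi t.
Proof. by rewrite /expi cos_2piDz sin_2piDz. Qed.

Lemma normc_expi t : Normc.normc (expi t) = 1.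
Proof. by rewrite /= cos2Dsin2 sqrtr1. Qed.

Lemma expi_natM n t : expi (n%:R * t) = expi t ^+ n.
Proof.
elim: n => [|n IH]; first by rewrite mul0r expi0 expr0.
by rewrite -natr1 mulrDl mul1r expiD IH exprSr.
Qed.

End ComplexExponential.

Section TorusPolynomial.
Context (R : realType) (d : nat).
Local Notation C := R[i].
Local Notation pt := (d.-tuple (measurableTypeR R)).
Local Notation mu := (torus_measure R d).
Local Notation freq := (d.-tuple int).
Implicit Types (f g : pt -> C) (h k : freq) (s : seq freq) (c : freq -> C).

Definition trig_poly c s (x : pt) : C := \sum_(h <- s) c h * expi (dotx h x).

Lemma dotxB h k x : dotx [tuple tnth h j - tnth k j | j < d] x = dotx h x - dotx k x :> R.
Proof.
rewrite -dotxN -dotxD; congr dotx; apply: eq_from_tnth => j.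
by rewrite !tnth_mktuple.
Qed.

Lemma expi_dotx_mod1 h (x : pt) : expi (dotx h (mod1 x)) = expi (dotx h x).
Proof.
rewrite -(expiDz (dotx h (mod1 x)) (\sum_(j < d) tnth h j * Num.floor (tnth x j))).
congr expi; rewrite /dotx rmorph_sum /= -big_split /=; apply: eq_bigr => j _.
by rewrite tnth_mktuple mulrBr rmorphM /= subrK.
Qed.

Lemma measurable_expi_dotx h :
  measurable_fun setT (fun x : pt => complex.Re (expi (dotx h x))) /\
  measurable_fun setT (fun x : pt => complex.Im (expi (dotx h x))).
Proof.
split; first exact: trig_measurable (trig_cos R h).
exact: trig_measurable (trig_sin R h).
Qed.

Lemma L1_torus_expi h : L1_torus (fun x : pt => expi (dotx h x)).
Proof.
have [mR mI] := measurable_expi_dotx h.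
split; apply: (@integrable_bounded _ _ _ mu _ 1) => // x.
  exact: cos_max.
exact: sin_max.
Qed.

Lemma L1_torusD f g : L1_torus f -> L1_torus g -> L1_torus (fun x => f x + g x).
Proof.
move=> [fR fI] [gR gI]; split.
  rewrite (_ : _ \o _ = (fun x => (complex.Re (f x))%:E + (complex.Re (g x))%:E)%E).
    exact: integrableD.
  by apply/funext => x /=; rewrite ReD.
rewrite (_ : _ \o _ = (fun x => (complex.Im (f x))%:E + (complex.Im (g x))%:E)%E).
  exact: integrableD.
by apply/funext => x /=; rewrite ImD.
Qed.

Lemma L1_torusZ (a : C) f : L1_torus f -> L1_torus (fun x => a * f x).
Proof.
case: a => a b [fR fI].
have I (r : R) (u : pt -> R) : mu.-integrable setT (EFin \o u) ->
    mu.-integrable setT (EFin \o (fun x => r * u x)).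
  by move=> iu; exact: (integrableZl measurableT r iu).
split.
  rewrite (_ : _ \o _ = (fun x => (a * complex.Re (f x))%:E - (b * complex.Im (f x))%:E)%E).
    by apply: integrableB => //; exact: I.
  by apply/funext => x /=; case: (f x).
rewrite (_ : _ \o _ = (fun x => (a * complex.Im (f x))%:E + (b * complex.Re (f x))%:E)%E).
  by apply: integrableD => //; exact: I.
by apply/funext => x /=; case: (f x) => *.
Qed.

Lemma integral_torusD f g : L1_torus f -> L1_torus g ->
  integral_torus (fun x => f x + g x) = integral_torus f + integral_torus g.
Proof.
move=> [fR fI] [gR gI]; rewrite /integral_torus.
under eq_Rintegral do rewrite ReD; under [X in (_ +i* X)%C]eq_Rintegral do rewrite ImD.
by rewrite !RintegralD.
Qed.

Lemma integral_torusZ (a : C) f : L1_torus f ->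
  integral_torus (fun x => a * f x) = a * integral_torus f.
Proof.
case: a => a b [fR fI]; rewrite /integral_torus.
have I (r : R) (u : pt -> R) : mu.-integrable setT (EFin \o u) ->
    mu.-integrable setT (EFin \o (fun x => r * u x)).
  by move=> iu; exact: (integrableZl measurableT r iu).
have -> : \int[mu]_x complex.Re ((a +i* b)%C * f x) =
    \int[mu]_x (a * complex.Re (f x) - b * complex.Im (f x)).
  by apply: eq_Rintegral => x _; case: (f x).
have -> : \int[mu]_x complex.Im ((a +i* b)%C * f x) =
    \int[mu]_x (a * complex.Im (f x) + b * complex.Re (f x)).
  by apply: eq_Rintegral => x _; case: (f x).
rewrite RintegralB ?RintegralD ?RintegralZl //; exact: I.
Qed.

Lemma integral_torus_expi h :
  integral_torus (fun x : pt => expi (dotx h x)) = (h == [tuple 0 | j < d])%:R.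
Proof.
case: eqP => [->|hn].
  have E (x : pt) : expi (dotx [tuple 0 | _ < d] x) = 1 :> C.
    by rewrite /dotx big1 ?expi0 // => j _; rewrite tnth_mktuple mul0r.
  rewrite /integral_torus; congr (_ +i* _)%C.
    by under eq_Rintegral do rewrite E; exact: Rintegral_cst_probability.
  by under eq_Rintegral do rewrite E; exact: Rintegral_cst_probability.
have [j hj] : exists j, tnth h j != 0.
  apply: contra_notP hn => /forallNP h0; apply: eq_from_tnth => j.
  by rewrite tnth_mktuple; apply/eqP/negPn/negP; exact: h0.
have [] := @torus_Rintegral_trig R d h (ex_intro _ j hj).
by rewrite /integral_torus /= => -> ->.
Qed.

Lemma L1_trig_poly c s : L1_torus (trig_poly c s).
Proof.
elim: s => [|h s IH].
  rewrite (_ : trig_poly c [::] = fun x => 0 * expi (dotx [tuple 0 | _ < d] x)).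
    by apply: L1_torusZ; exact: L1_torus_expi.
  by apply/funext => x; rewrite /trig_poly big_nil mul0r.
rewrite (_ : trig_poly c (h :: s) = fun x => c h * expi (dotx h x) + trig_poly c s x).
  by apply: L1_torusD => //; apply: L1_torusZ; exact: L1_torus_expi.
by apply/funext => x; rewrite /trig_poly big_cons.
Qed.

Lemma L1_torus_mul_expi f h : L1_torus f ->
  L1_torus (fun x => f x * expi (- dotx h x)).
Proof.
move=> [fR fI]; have tc := trig_cos R h; have ts := trig_sin R h.
split.
  rewrite (_ : _ \o _ = (fun x => (complex.Re (f x) * cos (2 * pi * dotx h x))%:E +
      (complex.Im (f x) * sin (2 * pi * dotx h x))%:E)%E).
    by apply: integrableD => //; exact: integrable_mul_trig.
  apply/funext => x /=; case: (f x) => a b /=.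
  by rewrite mulrN cosN sinN mulrN opprK.
rewrite (_ : _ \o _ = (fun x => (complex.Im (f x) * cos (2 * pi * dotx h x))%:E -
    (complex.Re (f x) * sin (2 * pi * dotx h x))%:E)%E).
  by apply: integrableB => //; exact: integrable_mul_trig.
apply/funext => x /=; case: (f x) => a b /=.
by rewrite mulrN cosN sinN mulrN -EFinD addrC.
Qed.

Lemma fourier_coef_trig_poly c s h : uniq s ->
  fourier_coef (trig_poly c s) h = if h \in s then c h else 0.
Proof.
rewrite /fourier_coef; have Z : integral_torus (fun x : pt => 0 : C) = 0.
  by congr (_ +i* _)%C; exact: Rintegral_cst_probability.
elim: s => [|k s IH] /= => [_|/andP[ks us]].
  rewrite -[RHS]Z; congr integral_torus; apply/funext => x.
  by rewrite /trig_poly big_nil mul0r.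
rewrite (_ : (fun x : pt => _) = fun x =>
    c k * expi (dotx [tuple tnth k j - tnth h j | j < d] x) +
    trig_poly c s x * expi (- dotx h x)); last first.
  by apply/funext => x; rewrite /trig_poly big_cons mulrDl dotxB expiD mulrA.
rewrite integral_torusD; last 2 first.
- by apply: L1_torusZ; exact: L1_torus_expi.
- by apply: L1_torus_mul_expi; exact: L1_trig_poly.
rewrite integral_torusZ ?IH // ?integral_torus_expi; last exact: L1_torus_expi.
have -> : ([tuple tnth k j - tnth h j | j < d] == [tuple 0 | _ < d]) = (h == k).
  apply/eqP/eqP => [E|->]; apply: eq_from_tnth => j; last by rewrite !tnth_mktuple subrr.
  by have := congr1 (fun t => tnth t j) E; rewrite !tnth_mktuple => /eqP; rewrite subr_eq0 => /eqP.
rewrite inE; case: eqP => [->|_] /=; last by rewrite mulr0 add0r.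
by rewrite (negbTE ks) mulr1 addr0.
Qed.

Lemma trig_poly_mod1 c s (x : pt) : trig_poly c s (mod1 x) = trig_poly c s x.
Proof. by apply: eq_bigr => h _; rewrite expi_dotx_mod1. Qed.

End TorusPolynomial.
(** * Absolutely convergent Fourier series *)

Section CountableEnumeration.
Variable T : countType.

(** Nested finite lists that exhaust T, so that a sum over T becomes an ordinary
    series and its partial sums are sums over duplicate-free lists. *)
Definition enum_upto n : seq T := pmap (@pickle_inv T) (iota 0 n).

Lemma enum_upto_uniq n : uniq (enum_upto n).
Proof. by apply: (pmap_uniq (@pickle_invK T)); exact: iota_uniq. Qed.

Lemma mem_enum_upto n x : (x \in enum_upto n) = (choice.pickle x < n)%N.
Proof.
rewrite /enum_upto mem_pmap; apply/mapP/idP => [|xn].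
  case=> i; rewrite mem_iota /= add0n => ilt E.
  by have := @pickle_invK T i; rewrite -E /= => ->.
by exists (choice.pickle x); rewrite ?mem_iota ?pickleK_inv.
Qed.

Lemma big_enum_upto (R : nmodType) n (F : T -> R) :
  \sum_(x <- enum_upto n) F x = \sum_(0 <= i < n) oapp F 0 (@pickle_inv T i).
Proof.
rewrite /index_iota subn0 /enum_upto; elim: (iota 0 n) => [|i s IH] /=.
  by rewrite !big_nil.
by rewrite big_cons -IH; case: pickle_inv => [x|] /=; rewrite ?big_cons ?add0r.
Qed.

End CountableEnumeration.

Lemma series_dominated (R : realType) (u a : R^nat) :
  (forall i, `|u i| <= a i) -> cvgn (series a) ->
  cvgn (series u) /\
  forall n, `|limn (series u) - series u n| <= limn (series a) - series a n.
Proof.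
move=> ua ca.
have cu : cvgn (series u).
  apply: normed_cvg; apply: series_le_cvg ca => [n|n|n].
  - exact: normr_ge0.
  - by apply: le_trans (ua n); exact: normr_ge0.
  - exact: ua.
split=> // n.
have cd : `|series u m - series u n| @[m --> \oo] --> `|limn (series u) - series u n|.
  by apply: cvg_norm; apply: cvgB => //; exact: cvg_cst.
have ce : series a m - series a n @[m --> \oo] --> limn (series a) - series a n.
  by apply: cvgB => //; exact: cvg_cst.
apply: ler_cvg_to cd ce _; exists n => // m /= nm.
rewrite !sub_series_geq // (le_trans (ler_norm_sum _ _ _)) //.
by apply: ler_sum => i _; exact: ua.
Qed.

Lemma unif_cvg_continuous (R : realType) (U : topologicalType)
    (F : nat -> U -> R) (f : U -> R) (e : R^nat) :
  e @ \oo --> (0 : R) -> (forall n y, `|f y - F n y| <= e n) ->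
  (forall n, continuous (F n)) -> continuous f.
Proof.
move=> e0 fF cF y; apply/cvgrPdist_lt => r r0.
have r3 : 0 < r / 3 by rewrite divr_gt0.
have /cvgrPdist_lt /(_ _ r3) [n _ /(_ n (leqnn n))] := e0.
rewrite sub0r normrN => /= en.
have /cvgrPdist_lt /(_ _ r3) Fn := cF n y.
near=> z.
have h1 := fF n y; have h2 := fF n z.
have h3 : `|F n y - F n z| < r / 3 by near: z; exact: Fn.
have h4 : e n < r / 3 by rewrite (le_lt_trans _ en) // ler_norm.
rewrite distrC in h2.
have -> : f y - f z = (f y - F n y) + (F n y - F n z) + (F n z - f z) by ring.
rewrite (le_lt_trans (ler_normD _ _)) //.
have := ler_normD (f y - F n y) (F n y - F n z).
lra.
Unshelve. all: by end_near. Qed.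

Section FourierSeries.
Context (R : realType) (d : nat).
Local Notation C := R[i].
Local Notation pt := (d.-tuple (measurableTypeR R)).
Local Notation mu := (torus_measure R d).
Local Notation freq := (d.-tuple int).
Implicit Types (f g : pt -> C) (h k : freq) (s : seq freq) (c : freq -> C).

(** Real and imaginary parts are compared separately because integrability and
    continuity of complex functions are defined through them. *)
Definition unif_close f g (e : R) := forall x,
  `|complex.Re (f x) - complex.Re (g x)| <= e /\
  `|complex.Im (f x) - complex.Im (g x)| <= e.

(** The Weierstrass test: e n is the tail of the series of the moduli. *)
Lemma summable_fourier_series c (B : R) :
  (forall s, uniq s -> \sum_(h <- s) Normc.normc (c h) <= B) ->
  exists G : pt -> C, exists e : R^nat, e @ \oo --> (0 : R) /\
    forall n, unif_close G (trig_poly c (enum_upto freq n)) (e n).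
Proof.
move=> cB; pose a i := oapp (fun h => Normc.normc (c h)) 0 (@pickle_inv freq i).
have a0 i : 0 <= a i by rewrite /a; case: pickle_inv => //= h; exact: normc_ge0.
have ca : cvgn (series a).
  apply: nondecreasing_is_cvgn.
    by apply/nondecreasing_seqP => n; rewrite -subr_ge0 seriesSB.
  by exists B => _ [n _ <-]; rewrite /series /= -big_enum_upto cB ?enum_upto_uniq.
pose t (r : C -> R) x i := oapp (fun h => r (c h * expi (dotx h x))) 0 (@pickle_inv freq i).
have D (r : C -> R) : (forall z, `|r z| <= Normc.normc z) -> forall x : pt,
    (forall i, `|t r x i| <= a i).
  move=> rn x i; rewrite /t /a; case: pickle_inv => [h|] /=; last by rewrite normr0.
  by rewrite (le_trans (rn _)) // Normc.normcM normc_expi mulr1.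
pose G (x : pt) : C :=
  (limn (series (t (@complex.Re R) x)) +i* limn (series (t (@complex.Im R) x)))%C.
exists G, (fun n => limn (series a) - series a n); split.
  by rewrite -(subrr (limn (series a))); apply: cvgB => //; exact: cvg_cst.
move=> n x; rewrite /trig_poly Re_sum Im_sum !big_enum_upto.
split.
  exact: (series_dominated (D _ (@ler_Re_normc R) x) ca).2.
exact: (series_dominated (D _ (@ler_Im_normc R) x) ca).2.
Qed.

Lemma continuous_trig_poly c s : continuous_torus (trig_poly c s : pt -> C).
Proof.
pose row (y : 'rV[R]_d) : pt := [tuple y ord0 j | j < d].
have ac : continuous (fun z : R * R => z.1 + z.2) by exact: add_continuous.
have cZ (U : topologicalType) (k : R) (f : U -> R) :
    continuous f -> continuous (fun y => k * f y).
  by move=> cf y; apply: cvgMr; exact: cf.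
have cD (U : topologicalType) (f g : U -> R) :
    continuous f -> continuous g -> continuous (fun y => f y + g y).
  by move=> cf cg y; apply: cvgD; [exact: cf | exact: cg].
have cdot h : continuous (fun y => 2 * pi * dotx h (row y)).
  apply: (cZ).
  rewrite (_ : (fun y : 'rV[R]_d => _) =
      fun y : 'rV[R]_d => \sum_(j < d) (tnth h j)%:~R * y ord0 j).
    by apply: (continuous_big ac) => j _; apply: (cZ); exact: coord_continuous.
  by apply/funext => y; apply: eq_bigr => j _; rewrite tnth_mktuple.
have ccos h : continuous (fun y => cos (2 * pi * dotx h (row y))).
  by move=> y; apply: continuous_comp; [exact: cdot | exact: continuous_cos].
have csin h : continuous (fun y => sin (2 * pi * dotx h (row y))).
  by move=> y; apply: continuous_comp; [exact: cdot | exact: continuous_sin].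
split.
  rewrite (_ : (fun y : 'rV[R]_d => _) = fun y : 'rV[R]_d => \sum_(h <- s)
      (complex.Re (c h) * cos (2 * pi * dotx h (row y)) +
       (- complex.Im (c h)) * sin (2 * pi * dotx h (row y)))).
    by apply: (continuous_big ac) => h _; apply: cD; apply: cZ.
  apply/funext => y; rewrite trig_poly_mod1 Re_sum; apply: eq_bigr => h _.
  by case: (c h) => a b /=; rewrite mulNr.
rewrite (_ : (fun y : 'rV[R]_d => _) = fun y : 'rV[R]_d => \sum_(h <- s)
    (complex.Re (c h) * sin (2 * pi * dotx h (row y)) +
     complex.Im (c h) * cos (2 * pi * dotx h (row y)))).
  by apply: (continuous_big ac) => h _; apply: cD; apply: cZ.
apply/funext => y; rewrite trig_poly_mod1 Im_sum; apply: eq_bigr => h _.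
by case: (c h) => a b /=.
Qed.

Lemma unif_close_continuous G (P : nat -> pt -> C) (e : R^nat) :
  e @ \oo --> (0 : R) -> (forall n, unif_close G (P n) (e n)) ->
  (forall n, continuous_torus (P n)) -> continuous_torus G.
Proof.
move=> e0 GP cP; split; apply: (unif_cvg_continuous e0) => [n y|n].
- exact: (GP n _).1.
- exact: (cP n).1.
- exact: (GP n _).2.
- exact: (cP n).2.
Qed.

Lemma cvg_of_close (u : R^nat) l (e : R^nat) :
  e @ \oo --> (0 : R) -> (forall n, `|l - u n| <= e n) -> u @ \oo --> l.
Proof.
move=> e0 lu; apply/cvgrPdist_le => r r0.
have /cvgrPdist_le /(_ _ r0) := e0; apply: filterS => n.
by rewrite sub0r normrN => en; rewrite (le_trans (lu n)) // (le_trans (ler_norm _)).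
Qed.

Lemma unif_close_L1 G (P : nat -> pt -> C) (e : R^nat) :
  e @ \oo --> (0 : R) -> (forall n, unif_close G (P n) (e n)) ->
  (forall n, L1_torus (P n)) -> L1_torus G.
Proof.
move=> e0 GP LP.
have I (u v : pt -> R) r : measurable_fun setT u -> mu.-integrable setT (EFin \o v) ->
    (forall x, `|u x - v x| <= r) -> mu.-integrable setT (EFin \o u).
  move=> mu_ iv uv.
  have mv : measurable_fun setT v by have /measurable_int/measurable_EFinP := iv.
  have -> : EFin \o u = (fun x => (u x - v x)%:E + (v x)%:E)%E.
    by apply/funext => x /=; rewrite -EFinD subrK.
  apply: integrableD => //; apply: (@integrable_bounded _ _ _ mu _ r) => //.
  exact: measurable_funB.
split; [apply: I (LP 0).1 (fun x => (GP 0 x).1) | apply: I (LP 0).2 (fun x => (GP 0 x).2)].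
  apply: (@measurable_fun_cvg _ _ _ _ (fun n x => complex.Re (P n x))).
    by move=> n; have /measurable_int/measurable_EFinP := (LP n).1.
  by move=> x _; apply: cvg_of_close e0 _ => n; exact: (GP n x).1.
apply: (@measurable_fun_cvg _ _ _ _ (fun n x => complex.Im (P n x))).
  by move=> n; have /measurable_int/measurable_EFinP := (LP n).2.
by move=> x _; apply: cvg_of_close e0 _ => n; exact: (GP n x).2.
Qed.

Lemma Rintegral_close (u v : pt -> R) r :
  mu.-integrable setT (EFin \o u) -> mu.-integrable setT (EFin \o v) ->
  (forall x, `|u x - v x| <= r) ->
  `|\int[mu]_x u x - \int[mu]_x v x| <= r.
Proof.
move=> iu iv uv; rewrite -RintegralB //.
have iuv : mu.-integrable setT (EFin \o (fun x => u x - v x)).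
  rewrite (_ : _ \o _ = (fun x => (u x)%:E - (v x)%:E)%E) //.
  exact: integrableB.
apply: (le_trans (le_normr_Rintegral _ _)) => //.
rewrite -[leRHS](Rintegral_cst_probability mu r).
apply: le_Rintegral => //.
- exact: integrable_norm.
- exact: finite_measure_integrable_cst.
Qed.

Lemma ler_norm_Re_mul_expi (z : C) t e :
  `|complex.Re z| <= e -> `|complex.Im z| <= e ->
  `|complex.Re (z * expi t)| <= 2 * e /\ `|complex.Im (z * expi t)| <= 2 * e.
Proof.
move=> h1 h2; have h : Normc.normc (z * expi t) <= 2 * e.
  rewrite Normc.normcM normc_expi mulr1 (le_trans (ler_normc_ReIm z)) //.
  by rewrite mulr2n mulrDl mul1r lerD.
by split; [exact: le_trans (ler_Re_normc _) h | exact: le_trans (ler_Im_normc _) h].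
Qed.

Lemma unif_close_fourier_coef f g e h : L1_torus f -> L1_torus g ->
  unif_close f g e ->
  `|complex.Re (fourier_coef f h) - complex.Re (fourier_coef g h)| <= 2 * e /\
  `|complex.Im (fourier_coef f h) - complex.Im (fourier_coef g h)| <= 2 * e.
Proof.
move=> Lf Lg fg.
have [fR fI] := L1_torus_mul_expi h Lf; have [gR gI] := L1_torus_mul_expi h Lg.
pose u (x : pt) : C := expi (- dotx h x).
have B x : `|complex.Re (f x * u x) - complex.Re (g x * u x)| <= 2 * e /\
    `|complex.Im (f x * u x) - complex.Im (g x * u x)| <= 2 * e.
  rewrite -ReB -ImB -mulrBl.
  by apply: ler_norm_Re_mul_expi; rewrite ?ReB ?ImB; case: (fg x).
by split; apply: Rintegral_close => // x; case: (B x).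
Qed.

(** Coefficients depend continuously on the function in the uniform norm, and
    the partial sums have h-th coefficient c h as soon as h has been enumerated. *)
Lemma fourier_coef_series c G (e : R^nat) h :
  e @ \oo --> (0 : R) ->
  (forall n, unif_close G (trig_poly c (enum_upto freq n)) (e n)) ->
  fourier_coef G h = c h.
Proof.
move=> e0 Ge.
have LG : L1_torus G by apply: unif_close_L1 e0 Ge _ => n; exact: L1_trig_poly.
have B n : (choice.pickle h < n)%N ->
    `|complex.Re (fourier_coef G h) - complex.Re (c h)| <= 2 * e n /\
    `|complex.Im (fourier_coef G h) - complex.Im (c h)| <= 2 * e n.
  move=> hn; have := unif_close_fourier_coef h LG (L1_trig_poly c (enum_upto freq n)) (Ge n).
  by rewrite fourier_coef_trig_poly ?enum_upto_uniq // mem_enum_upto hn.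
have e2 : 2 * e n @[n --> \oo] --> (0 : R).
  by rewrite -(mulr0 2); apply: cvgMr.
have Z (x : R) : (forall n, (choice.pickle h < n)%N -> `|x| <= 2 * e n) -> x = 0.
  move=> xe; apply/eqP; rewrite -normr_le0 -(cvg_lim (@Rhausdorff R) e2).
  apply: limr_ge; first by apply/cvg_ex; exists 0.
  by exists (choice.pickle h).+1.
have hR := Z _ (fun n hn => (B n hn).1); have hI := Z _ (fun n hn => (B n hn).2).
move/eqP: hR; move/eqP: hI; rewrite !subr_eq0.
by case: (fourier_coef G h) (c h) => a b [a' b'] /= /eqP -> /eqP ->.
Qed.

(** If f and g differed at a point of the cube, they would differ, by continuity,
    on a box having this point as its lower corner; such a box stays inside the
    cube and has positive measure. *)
Lemma continuous_torus_ae_eq f g : continuous_torus f -> continuous_torus g ->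
  (\forall x \ae mu, f x = g x) -> forall x : pt, f (mod1 x) = g (mod1 x).
Proof.
pose row (y : 'rV[R]_d) : pt := [tuple y ord0 j | j < d].
move=> [fR fI] [gR gI] fg x.
have K (r : C -> R) : continuous (fun y => r (f (mod1 (row y)))) ->
    continuous (fun y => r (g (mod1 (row y)))) -> r (f (mod1 x)) = r (g (mod1 x)).
  move=> cf cg; apply/eqP/negPn/negP => neq.
  pose y0 : 'rV[R]_d := \row_j tnth (mod1 x) j.
  have Ey0 : mod1 (row y0) = mod1 x.
    have -> : row y0 = mod1 x by apply: eq_from_tnth => j; rewrite tnth_mktuple mxE.
    by apply: mod1_id => j; exact: mod1_itv.
  have cD : continuous (fun y => r (f (mod1 (row y))) - r (g (mod1 (row y)))).
    by move=> y; apply: (@cvgB _ _ _ _ (nbhs_filter y)); [exact: cf | exact: cg].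
  have : \forall y \near y0, r (f (mod1 (row y))) - r (g (mod1 (row y))) != 0.
    by apply: (cvgr_neq0 _ (cD y0)); rewrite Ey0 subr_eq0.
  move=> /nbhs_ballP [e /= e0 He].
  pose a j := y0 ord0 j; pose b j := Num.min (y0 ord0 j + e) 1.
  have a01 j : 0 <= a j < 1 by rewrite /a mxE mod1_itv.
  have : (0 < mu [set z | forall j, (a j < tnth z j < b j)%R])%E.
    apply: torus_measure_itvoo_gt0 => j.
    - by case/andP: (a01 j).
    - by rewrite /b lt_min ltrDl e0 /=; case/andP: (a01 j).
    - by rewrite /b ge_min lexx orbT.
  apply/negP; rewrite -leNgt.
  have [N [mN N0 sN]] := fg.
  rewrite -N0; apply: le_measure; rewrite ?inE //.
    pose I j := `]a j, b j[%classic : set (measurableTypeR R).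
    rewrite (_ : mkset _ = [set z : pt | forall j, I j (tnth z j)]).
      by apply: measurable_box => j; exact: measurable_itv.
    by apply/seteqP; split=> z h j; have := h j; rewrite /I /= in_itv.
  move=> z zab; apply: sN => /= fgz.
  have z01 j : 0 <= tnth z j < 1.
    have := zab j; rewrite /b lt_min => /and3P[h1 _ ->]; rewrite andbT.
    by rewrite ltW // (le_lt_trans _ h1) //; case/andP: (a01 j).
  pose y : 'rV[R]_d := \row_j tnth z j.
  have Ey : row y = z by apply: eq_from_tnth => j; rewrite tnth_mktuple mxE.
  have : ball y0 e y.
    split => // i j; rewrite (ord1 i) [y _ _]mxE /ball /=.
    have := zab j; rewrite /b lt_min => /and3P[h1 h2 _].
    by rewrite /ball_ /= -/(a j) ltr0_norm ?subr_lt0 // opprB ltrBlDl.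
  by move/He; rewrite /= Ey (mod1_id z01) fgz subrr eqxx.
have KR := K (@complex.Re R) fR gR; have KI := K (@complex.Im R) fI gI.
by move: KR KI; case: (f _) (g _) => p q [p' q'] /= -> ->.
Qed.

End FourierSeries.
(** * Aliasing on a multiple rank-1 lattice *)

Section RootsOfUnity.
Variable R : realType.
Local Notation C := R[i].

Lemma expi_neq1 (t : R) : 0 < t < 1 -> expi t != 1.
Proof.
move=> /andP[t0 t1]; have pi0 := pi_gt0 R.
apply/negP => /eqP [c1 s0].
have [th|th] := leP t 2^-1.
  have : cos (2 * pi * t) < cos 0.
    rewrite ltr_cos ?in_itv /=; first by rewrite !mulr_gt0.
      by rewrite lexx ltW.
    by apply/andP; split; nra.
  by rewrite c1 cos0 ltxx.
have := @ge_half_trig R t t; rewrite (ltW t0) t1 th (ltW t1) lexx s0 ltxx /=.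
by move=> /(_ isT isT).
Qed.

Lemma expi_int (k : int) : expi (k%:~R : R) = 1.
Proof. by rewrite -[k%:~R]add0r expiDz expi0. Qed.

Lemma expi_frac_eq1 (m : nat) (k : int) : (0 < m)%N ->
  (expi (k%:~R / m%:R : R) == 1) = (m%:Z %| k)%Z.
Proof.
move=> m0; have mR : (m%:R : R) != 0 by rewrite pnatr_eq0 -lt0n.
have E : k%:~R / m%:R = ((k %% m)%Z%:~R / m%:R : R) + (k %/ m)%Z%:~R.
  rewrite {1}(divz_eq k m) intrD intrM mulrDl mulfK // addrC //.
rewrite E expiDz; apply/eqP/idP => [e1|/dvdz_mod0P ->]; last by rewrite mul0r expi0.
apply: contra_eqT e1 => nd; apply: expi_neq1.
have r0 : (0 <= (k %% m)%Z) by rewrite modz_ge0 // -lt0n.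
have rm : ((k %% m)%Z < m%:Z) by rewrite ltz_pmod.
have rn : (k %% m)%Z != 0 by apply: contra nd => /eqP h; apply/dvdz_mod0P.
apply/andP; split.
  by rewrite divr_gt0 ?ltr0n // ltr0z lt_neqAle eq_sym rn r0.
by rewrite ltr_pdivrMr ?ltr0n // mul1r -[m%:R]/(m%:Z%:~R) ltr_int.
Qed.

(** A geometric sum over an m-th root of unity: it telescopes to 0 unless the root
    is 1. *)
Lemma sum_expi_frac (m : nat) (k : int) : (0 < m)%N ->
  m%:R^-1 * \sum_(j < m) expi (j%:R * (k%:~R / m%:R) : R) = (m%:Z %| k)%Z%:R :> C.
Proof.
move=> m0; have mR : (m%:R : C) != 0 by rewrite pnatr_eq0 -lt0n.
under eq_bigr do rewrite expi_natM.
rewrite -expi_frac_eq1 //; set w := expi _; case: eqP => [->|/eqP w1].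
  under eq_bigr do rewrite expr1n.
  by rewrite sumr_const card_ord mulVf.
have : w ^+ m = 1.
  by rewrite -expi_natM mulrCA divff ?mulr1 ?expi_int // pnatr_eq0 -lt0n.
move/eqP; rewrite -subr_eq0 subrX1 mulf_eq0 subr_eq0 (negbTE w1) /= => /eqP ->.
by rewrite mulr0.
Qed.

End RootsOfUnity.

(** Stated for sums with a boolean coefficient because this is what the lattice
    rule makes of a character: 1 on its aliases and 0 elsewhere. *)
Lemma big_at_most_one (R : pzRingType) (T : eqType) (s : seq T) (b : pred T)
    (F : T -> R) :
  uniq s -> {in s &, forall h h', b h -> b h' -> h = h'} ->
  (exists h0, [/\ h0 \in s, b h0 & \sum_(h <- s) (b h)%:R * F h = F h0]) \/
  (\sum_(h <- s) (b h)%:R * F h = 0 /\ {in s, forall h, ~~ b h}).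
Proof.
move=> us ub; have [/hasP[h0 hs bh]|/hasPn nb] := boolP (has b s).
  left; exists h0; split=> //.
  rewrite (bigD1_seq h0) //= bh mul1r big_seq_cond big1 ?addr0 // => h /andP[h1 h2].
  case: (boolP (b h)) => [bh'|]; last by rewrite mul0r.
  by rewrite (ub h h0) ?eqxx in h2.
right; split=> //; rewrite big_seq big1 // => h /nb /negbTE ->.
by rewrite mul0r.
Qed.

Section LatticeApprox.
Context (R : realType) (d L : nat).
Variables (z : 'I_L -> d.-tuple int) (m : 'I_L -> nat) (A : set (d.-tuple int)).
Hypothesis m_gt0 : forall l, (0 < m l)%N.
Hypothesis finA : finite_set A.
Hypothesis coverA : A = \bigcup_(l in [set: 'I_L]) freq_part z m A l.
Local Notation C := R[i].
Local Notation pt := (d.-tuple (measurableTypeR R)).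
Local Notation freq := (d.-tuple int).
Local Notation part := (freq_part z m A).
Local Notation S := (@lattice_approx R d L z m A).
Implicit Types (f g : pt -> C) (h k : freq) (l : 'I_L) (x : pt).

Lemma freq_upto_mono n n' : (n <= n')%N ->
  freq_upto z m A n `<=` freq_upto z m A n'.
Proof.
move=> /subnK <-; elim: (n' - n)%N => [|i IH] //.
by apply: (subset_trans IH); rewrite addSn => h /=; left.
Qed.

Lemma freq_part_uptoS l : part l `<=` freq_upto z m A l.+1.
Proof. by move=> h hl /=; right; exists l. Qed.

Lemma freq_part_sub l : part l `<=` A.
Proof. by move=> h []. Qed.

Lemma freq_part_inj l l' h : part l h -> part l' h -> l = l'.
Proof.
have W (i j : 'I_L) : (i < j)%N -> part i h -> ~ part j h.
  move=> ij /freq_part_uptoS hi [_ nj _]; apply: nj.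
  exact: freq_upto_mono ij _ hi.
move=> hl hl'; apply/val_inj; case: (ltngtP l l') => // ll.
  by have := W _ _ ll hl hl'.
by have := W _ _ ll hl' hl.
Qed.

Lemma finite_freq_part l : finite_set (part l).
Proof. exact: sub_finite_set (@freq_part_sub l) finA. Qed.

Definition aliased l k h := (dotz h (z l) == dotz k (z l) %[mod (m l)%:Z])%Z.

Lemma dotx_lattice_point k (v : freq) (n j : nat) :
  expi (dotx k (lattice_point R v n j)) = expi (j%:R * ((dotz k v)%:~R / n%:R) : R).
Proof.
rewrite /lattice_point expi_dotx_mod1; congr expi.
rewrite /dotx /dotz rmorph_sum /= mulr_suml mulr_sumr; apply: eq_bigr => i _.
rewrite tnth_mktuple rmorphM /=; ring.
Qed.

(** The lattice rule integrates the character of frequency k - h exactly to 1 if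
    this frequency lies in the dual lattice and to 0 otherwise. *)
Lemma lattice_coef_expi k l h :
  lattice_coef z m (fun x : pt => expi (dotx k x)) l h = (aliased l k h)%:R.
Proof.
rewrite /aliased eq_sym eqz_mod_dvd -sum_expi_frac // /lattice_coef.
congr (_ * _); apply: eq_bigr => j _.
rewrite dotx_lattice_point -expiD; congr expi.
by rewrite rmorphB /=; ring.
Qed.

Lemma lattice_approxE f x :
  S f x = \sum_(l < L) \sum_(h <- fset_set (part l))
    lattice_coef z m f l h * expi (dotx h x).
Proof.
by apply: eq_bigr => l _; rewrite fsbig_finite //; exact: finite_freq_part.
Qed.

(** Two aliases of k are aliases of each other, which members of the same part
    cannot be. *)
Lemma freq_part_unique l k : {in fset_set (part l) &, forall h h',
  aliased l k h -> aliased l k h' -> h = h'}.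
Proof.
move=> h h'; rewrite !in_fset_set ?inE; [|exact: finite_freq_part..].
move=> [Ah _ nal] [Ah' _ _] /eqP e1 /eqP e2; apply/eqP/negPn/negP => /eqP hh'.
by apply: (nal h' Ah' (nesym hh')); rewrite e1 e2.
Qed.

(** A frequency of the index set is aliased only by itself in every part, and it
    lies in exactly one part; hence its character is reproduced. *)
Lemma lattice_approx_expi_in k x : A k ->
  S (fun x => expi (dotx k x)) x = expi (dotx k x).
Proof.
move=> Ak; have := Ak; rewrite {1}coverA => -[l0 _ kl0].
have kin l : part l k -> k \in fset_set (part l).
  by move=> kl; rewrite in_fset_set ?inE //; exact: finite_freq_part.
have alk l h : h \in fset_set (part l) -> aliased l k h -> h = k.
  rewrite in_fset_set ?inE; last exact: finite_freq_part.
  move=> [Ah _ nal] /eqP hk; apply/eqP/negPn/negP => /eqP hk'.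
  exact: nal k Ak (nesym hk') hk.
rewrite lattice_approxE (bigD1 l0) //= [X in _ + X]big1 ?addr0 => [|l ll0].
  under eq_bigr do rewrite lattice_coef_expi.
  have [[h0 [h0s /(alk _ _ h0s) -> ->//]]|[_ /(_ k (kin _ kl0))]] :=
    big_at_most_one (fun h => expi (dotx h x)) (fset_uniq _) (@freq_part_unique l0 k).
  by rewrite /aliased eqxx.
rewrite big_seq big1 // => h hl; rewrite lattice_coef_expi.
case: (boolP (aliased l k h)) => [/(alk _ _ hl) E|]; last by rewrite mul0r.
move: hl; rewrite E in_fset_set ?inE; last exact: finite_freq_part.
by move=> /(freq_part_inj kl0) e; rewrite e eqxx in ll0.
Qed.

(** Each part contains at most one alias of k, so each lattice contributes at most
    one character. *)
Lemma normc_lattice_approx_expi k x :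
  Normc.normc (S (fun x => expi (dotx k x)) x) <= L%:R.
Proof.
rewrite lattice_approxE (le_trans (ler_normc_sum _ _)) //.
rewrite -[leRHS]mulr1 -[L in leRHS]card_ord mulr_natl -sumr_const.
apply: ler_sum => l _; under eq_bigr do rewrite lattice_coef_expi.
have [[h0 [_ _ ->]]|[-> _]] :=
    big_at_most_one (fun h => expi (dotx h x)) (fset_uniq _) (@freq_part_unique l k).
  by rewrite normc_expi.
by rewrite Normc.normc0.
Qed.

Lemma lattice_coefD f g l h :
  lattice_coef z m (fun x => f x + g x) l h =
  lattice_coef z m f l h + lattice_coef z m g l h.
Proof.
rewrite /lattice_coef -mulrDr -big_split /=; congr (_ * _).
by apply: eq_bigr => j _; rewrite mulrDl.
Qed.

Lemma lattice_coefZ (a : C) f l h :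
  lattice_coef z m (fun x => a * f x) l h = a * lattice_coef z m f l h.
Proof.
rewrite /lattice_coef [RHS]mulrCA [in RHS]mulr_sumr; congr (_ * _).
by apply: eq_bigr => j _; rewrite mulrA.
Qed.

Lemma lattice_approxD f g x : S (fun x => f x + g x) x = S f x + S g x.
Proof.
rewrite !lattice_approxE -big_split /=; apply: eq_bigr => l _.
by rewrite -big_split /=; apply: eq_bigr => h _; rewrite lattice_coefD mulrDl.
Qed.

Lemma lattice_approxZ (a : C) f x : S (fun x => a * f x) x = a * S f x.
Proof.
rewrite !lattice_approxE mulr_sumr; apply: eq_bigr => l _.
by rewrite mulr_sumr; apply: eq_bigr => h _; rewrite lattice_coefZ mulrA.
Qed.

Lemma lattice_approx_trig_poly c (s : seq freq) x :
  S (trig_poly c s) x = \sum_(k <- s) c k * S (fun x => expi (dotx k x)) x.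
Proof.
elim: s => [|k s IH].
  rewrite big_nil (_ : trig_poly c [::] = fun x => 0 * expi (dotx [tuple 0 | _ < d] x)).
    by rewrite lattice_approxZ mul0r.
  by apply/funext => y; rewrite /trig_poly big_nil mul0r.
rewrite big_cons -IH -lattice_approxZ -lattice_approxD.
by congr (S _ x); apply/funext => y; rewrite /trig_poly big_cons.
Qed.

(** By linearity only the frequencies outside the index set contribute, each with
    at most itself and L aliases. *)
Lemma lattice_error_trig_poly c (s : seq freq) x :
  Normc.normc (trig_poly c s x - S (trig_poly c s) x) <=
  (1 + L%:R) * \sum_(k <- s | k \notin A) Normc.normc (c k).
Proof.
rewrite lattice_approx_trig_poly /trig_poly -sumrB.
rewrite (le_trans (ler_normc_sum _ _)) // mulr_sumr [leRHS]big_mkcond /=.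
apply: ler_sum => k _; rewrite -mulrBr Normc.normcM.
have [/set_mem kA|kA] := boolP (k \in A).
  by rewrite lattice_approx_expi_in // subrr Normc.normc0 mulr0.
rewrite mulrC ler_wpM2r ?normc_ge0 // (le_trans (le_normcD _ _)) //.
by rewrite normcN normc_expi lerD2l normc_lattice_approx_expi.
Qed.

Lemma normc_lattice_coef f l h e : (forall x, Normc.normc (f x) <= e) ->
  Normc.normc (lattice_coef z m f l h) <= e.
Proof.
move=> fe; have mR : (0 : R) < (m l)%:R by rewrite ltr0n.
rewrite /lattice_coef Normc.normcM Normc.normcV normc_nat ler_pdivrMl //.
rewrite (le_trans (ler_normc_sum _ _)) // -[X in X%:R * _]card_ord mulr_natl -sumr_const.
by apply: ler_sum => j _; rewrite Normc.normcM normc_expi mulr1.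
Qed.

(** For fixed x the algorithm is bounded in the uniform norm, being a finite
    combination of samples, so the bound passes from the partial sums to G. *)
Lemma lattice_error_series c G (e : R^nat) (B : R) x :
  e @ \oo --> (0 : R) ->
  (forall n, unif_close G (trig_poly c (enum_upto freq n)) (e n)) ->
  (forall n, \sum_(k <- enum_upto freq n | k \notin A) Normc.normc (c k) <= B) ->
  Normc.normc (G x - S G x) <= (1 + L%:R) * B.
Proof.
move=> e0 Ge cB; pose P n := trig_poly c (enum_upto freq n) : pt -> C.
have GP n y : Normc.normc (G y - P n y) <= 2 * e n.
  rewrite (le_trans (ler_normc_ReIm _)) // ReB ImB mulr2n mulrDl mul1r.
  by have [h1 h2] := Ge n y; exact: lerD.
pose K : R := 1 + \sum_(l < L) \sum_(h <- fset_set (part l)) 1.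
have SP n : Normc.normc (S (fun x => G x - P n x) x) <= (K - 1) * (2 * e n).
  rewrite lattice_approxE (le_trans (ler_normc_sum _ _)) // /K addrC addKr mulr_suml.
  apply: ler_sum => l _; rewrite (le_trans (ler_normc_sum _ _)) // mulr_suml.
  apply: ler_sum => h _; rewrite Normc.normcM normc_expi mulr1 mul1r.
  exact: normc_lattice_coef.
have H n : Normc.normc (G x - S G x) <= (1 + L%:R) * B + K * (2 * e n).
  have -> : G x - S G x =
      (P n x - S (P n) x) + ((G x - P n x) - S (fun x => G x - P n x) x).
    have -> : S G x = S (P n) x + S (fun x => G x - P n x) x.
      by rewrite -lattice_approxD; congr (S _ x); apply/funext => y; rewrite addrC subrK.
    by ring.
  rewrite (le_trans (le_normcD _ _)) // lerD //.
    rewrite (le_trans (lattice_error_trig_poly _ _ _)) // ler_wpM2l ?addr_ge0 //.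
  rewrite (le_trans (le_normcD _ _)) // normcN -[K](subrK 1) mulrDl mul1r addrC.
  by rewrite lerD.
have lim : (1 + L%:R) * B + K * (2 * e n) @[n --> \oo] --> (1 + L%:R) * B.
  rewrite -[X in _ --> X]addr0; apply: cvgD; first exact: cvg_cst.
  by rewrite -(mulr0 K); apply: cvgMr; rewrite -(mulr0 2); apply: cvgMr.
rewrite -(cvg_lim (@Rhausdorff R) lim); apply: limr_ge; last by apply: nearW.
by apply/cvg_ex; exists ((1 + L%:R) * B).
Qed.

End LatticeApprox.
(** * Counting frequencies by weight *)

(** The comparison of x^(-p) with its primitive, in a telescoping form.  After
    division by (x+1)^(1-p) it becomes the inequality
    (1 - 1/(x+1))^(1-p) >= 1 + (p-1)/(x+1), which follows from exp t >= 1 + t and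
    ln (1 + t) <= t. *)
Lemma powR_step (R : realType) (p x : R) : 1 < p -> 0 < x ->
  (x + 1) `^ (- p) <= (x `^ (1 - p) - (x + 1) `^ (1 - p)) / (p - 1).
Proof.
move=> p1 x0; have y0 : 0 < x + 1 by rewrite addr_gt0.
have q0 : 0 < p - 1 by rewrite subr_gt0.
rewrite ler_pdivlMr //.
have Ex : x `^ (1 - p) = (x + 1) `^ (1 - p) * (x / (x + 1)) `^ (1 - p).
  by rewrite -powRM ?ltW ?divr_gt0 // mulrC divfK // gt_eqF.
have Ey : (x + 1) `^ (- p) = (x + 1) `^ (1 - p) / (x + 1).
  rewrite -[X in _ / X]powRr1 ?ltW // -powRN -powRD; first by congr (_ `^ _); ring.
  by apply/implyP => _; rewrite gt_eqF.
rewrite Ex Ey -[X in _ <= _ - X]mulr1 -mulrBr -mulrA ler_pM2l ?powR_gt0 //.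
have xy0 : 0 < x / (x + 1) by rewrite divr_gt0.
rewrite /powR gt_eqF //.
have h1 := expR_ge1Dx ((1 - p) * ln (x / (x + 1))).
have h2 : ln (x / (x + 1)) <= - (x + 1)^-1.
  have -> : x / (x + 1) = 1 + (- (x + 1)^-1) by field; rewrite gt_eqF.
  by apply: le_ln1Dx; rewrite ltrN2 invf_lt1 // ltrDr.
have h3 : (p - 1) * (x + 1)^-1 <= (p - 1) * (- ln (x / (x + 1))).
  by rewrite ler_pM2l // lerNr.
by rewrite mulrC; lra.
Qed.

Lemma sum_powR_tail (R : realType) (p a : R) n : 1 < p -> 0 < a ->
  \sum_(k < n) (a + k.+1%:R) `^ (- p) <= a `^ (1 - p) / (p - 1).
Proof.
move=> p1 a0; have q0 : 0 < p - 1 by rewrite subr_gt0.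
suff : \sum_(k < n) (a + k.+1%:R) `^ (- p) <=
    (a `^ (1 - p) - (a + n%:R) `^ (1 - p)) / (p - 1).
  by move/le_trans; apply; rewrite ler_pM2r ?invr_gt0 // gerBl powR_ge0.
elim: n => [|n IH]; first by rewrite big_ord0 addr0 subrr mul0r.
rewrite big_ord_recr /= -natr1 addrA.
have an0 : 0 < a + n%:R by rewrite ltr_wpDr.
by have := lerD IH (powR_step p1 an0); rewrite -mulrDl addrA subrK.
Qed.

Lemma sum_le_zeta (R : realType) (s : R) n : 1 < s ->
  \sum_(k < n) (k.+1%:R `^ s)^-1 <= zeta s.
Proof.
move=> s1; pose u k : R := (k.+1%:R `^ s)^-1.
have u0 k : 0 <= u k by rewrite invr_ge0 powR_ge0.
have nd : nondecreasing_seq (series u).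
  by apply/nondecreasing_seqP => k; rewrite -subr_ge0 seriesSB.
have B k : series u k <= 1 + 1 / (s - 1).
  rewrite /series /= big_mkord; case: k => [|k].
    by rewrite big_ord0 addr_ge0 // divr_ge0 // subr_ge0 ltW.
  rewrite big_ord_recl /u powR1 invr1 lerD2l.
  have := sum_powR_tail k s1 ltr01; rewrite powR1; apply: le_trans; apply: ler_sum => i _.
  by rewrite powRN nat1r.
have -> : \sum_(k < n) (k.+1%:R `^ s)^-1 = series u n by rewrite /series /= big_mkord.
apply: nondecreasing_cvgn_le => //; apply: nondecreasing_is_cvgn => //.
by exists (1 + 1 / (s - 1)) => _ [k _ <-].
Qed.

Section SumOverBox.
Context (R : realType) (d : nat).
Local Notation freq := (d.-tuple int).

(** Lists the integers n with |n| <= K: first 0, ..., K, then -1, ..., -K.  The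
    split matches the two halves of the sum that defines 1 + 2 zeta. *)
Definition int_of_box K (i : 'I_(K.+1 + K)) : int :=
  match fintype.split i with inl j => Posz j | inr j => Negz j end.

Lemma int_of_box_lshift K j : int_of_box (lshift K j : 'I_(K.+1 + K)) = Posz j.
Proof. by rewrite /int_of_box -[lshift K j]/(fintype.unsplit (inl j)) unsplitK. Qed.

Lemma int_of_box_rshift K j : int_of_box (rshift K.+1 j : 'I_(K.+1 + K)) = Negz j.
Proof. by rewrite /int_of_box -[rshift _ j]/(fintype.unsplit (inr j)) unsplitK. Qed.

Lemma int_of_box_surj K (n : int) : (`|n| <= K)%N ->
  exists i : 'I_(K.+1 + K), int_of_box i = n.
Proof.
case: n => j jK.
  by exists (lshift K (Ordinal (jK : (j < K.+1)%N))); rewrite int_of_box_lshift.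
by exists (rshift K.+1 (Ordinal (jK : (j < K)%N))); rewrite int_of_box_rshift.
Qed.

Lemma sum_int_of_box K (F : int -> R) :
  \sum_(i < K.+1 + K) F (int_of_box i) =
  F 0 + \sum_(i < K) (F i.+1%:Z + F (- i.+1%:Z)).
Proof.
rewrite big_split_ord /= big_ord_recl -addrA; congr (F _ + _).
  by rewrite int_of_box_lshift.
rewrite big_split /=; congr (_ + _); apply: eq_bigr => i _.
  by rewrite int_of_box_lshift.
by rewrite int_of_box_rshift.
Qed.

(** The list s lies in a cube, over which the sum of products is the product of
    the one-dimensional sums. *)
Lemma sum_prod_le (F : 'I_d -> int -> R) (B : 'I_d -> R) :
  (forall j n, 0 <= F j n) ->
  (forall j K, F j 0 + \sum_(i < K) (F j i.+1%:Z + F j (- i.+1%:Z)) <= B j) ->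
  forall s : seq freq, uniq s ->
  \sum_(h <- s) \prod_(j < d) F j (tnth h j) <= \prod_(j < d) B j.
Proof.
move=> F0 FB s us.
have [K hK] : exists K, forall h, h \in s -> forall j, (`|tnth h j| <= K)%N.
  exists (\max_(h <- s) \max_(j < d) `|tnth h j|)%N => h hs j.
  apply: (@leq_trans (\max_(i < d) `|tnth h i|)%N); last exact: leq_bigmax_seq.
  exact: leq_bigmax.
pose g (h : freq) : {ffun 'I_d -> 'I_(K.+1 + K)} :=
  [ffun j => odflt ord0 [pick i | int_of_box i == tnth h j]].
have gK h j : h \in s -> int_of_box (g h j) = tnth h j.
  move=> hs; rewrite ffunE; case: pickP => [i /eqP //|ni].
  have [i Ei] := int_of_box_surj (hK h hs j).
  by have := ni i; rewrite Ei eqxx.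
have ug : uniq (map g s).
  rewrite map_inj_in_uniq // => h h' hs hs' E; apply: eq_from_tnth => j.
  by rewrite -(gK h) // -(gK h') // E.
pose W (y : {ffun 'I_d -> 'I_(K.+1 + K)}) := \prod_(j < d) F j (int_of_box (y j)).
have -> : \sum_(h <- s) \prod_(j < d) F j (tnth h j) = \sum_(y <- map g s) W y.
  rewrite big_map !big_seq; apply: eq_bigr => h hs; apply: eq_bigr => j _.
  by rewrite gK.
rewrite big_uniq // (le_trans (_ : _ <= \sum_y W y)) //.
  rewrite [leRHS](bigID (mem (map g s))) /= lerDl sumr_ge0 // => y _.
  by apply: prodr_ge0 => j _.
rewrite -(bigA_distr_bigA (fun j i => F j (int_of_box i))).
apply: ler_prod => j _; rewrite sumr_ge0 //=.
by rewrite sum_int_of_box.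
Qed.
End SumOverBox.
Lemma powR_prod (R : realType) (I : Type) (s : seq I) (f : I -> R) (p : R) :
  (forall i, 0 <= f i) ->
  (\prod_(i <- s) f i) `^ p = \prod_(i <- s) f i `^ p.
Proof.
move=> f0; elim: s => [|i s IH]; first by rewrite !big_nil powR1.
by rewrite !big_cons powRM ?IH // prodr_ge0.
Qed.

Lemma seq_argmax (R : realDomainType) (T : eqType) (r : T -> R) (s : seq T) :
  s != [::] -> exists2 h0, h0 \in s & forall h, h \in s -> r h <= r h0.
Proof.
elim: s => [//|h s IH] _; have [->|/IH [h0 h0s hmax]] := eqVneq s [::].
  by exists h; rewrite ?mem_head // => k; rewrite inE => /eqP ->.
have [hh0|/ltW hh0] := leP (r h) (r h0).
  exists h0; first by rewrite inE h0s orbT.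
  by move=> k; rewrite inE => /predU1P[->|/hmax].
exists h; first exact: mem_head.
by move=> k; rewrite inE => /predU1P[->//|/hmax/le_trans]; apply.
Qed.

Section WeightedCounting.
Context (R : realType) (T : eqType) (r : T -> R) (tau S : R).
Hypothesis r_ge1 : forall h, 1 <= r h.
Hypotheses (tau_gt0 : 0 < tau) (tau_lt1 : tau < 1).
Hypothesis sum_le : forall s, uniq s -> \sum_(h <- s) r h `^ (- tau) <= S.

Let r_gt0 h : 0 < r h. Proof. exact: lt_le_trans (r_ge1 h). Qed.

(** Markov's inequality for the counting measure. *)
Lemma size_weight_le s t : uniq s -> 0 < t -> (forall h, h \in s -> r h <= t) ->
  (size s)%:R * t `^ (- tau) <= S.
Proof.
move=> us t0 st; apply: le_trans (sum_le us).
have -> : (size s)%:R * t `^ (- tau) = \sum_(h <- s) t `^ (- tau).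
  by rewrite big_const_seq count_predT iter_addr_0 mulr_natl.
rewrite !big_seq; apply: ler_sum => h hs.
rewrite !powRN lef_pV2 ?posrE ?powR_gt0 //.
by apply: ge0_ler_powR; rewrite ?nnegrE ?(ltW tau_gt0) ?(ltW t0) ?(ltW (r_gt0 h)) ?st.
Qed.

(** Removing a member h0 of s of largest weight, all of sA and s has weight at most
    r h0.  Counting then bounds r h0 from below by a power of the total number
    of elements, so that the terms are dominated by consecutive terms of a
    convergent series.  This replaces sorting all frequencies by weight. *)
Lemma sum_weight_inv_tail sA s N : (0 < size sA)%N -> uniq sA -> uniq s ->
  (forall h, h \in sA -> r h <= N) -> (forall h, h \in s -> N < r h) ->
  \sum_(h <- s) (r h)^-1 <=
  S `^ tau^-1 * \sum_(k < size s) ((size sA)%:R + k.+1%:R) `^ (- tau^-1).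
Proof.
move=> a0 uA; move En : (size s) => n; elim: n s En => [|n IH] s En us sAN sN.
  by rewrite (size0nil En) big_nil big_ord0 mulr0.
have [h0 h0s hmax] : exists2 h0, h0 \in s & forall h, h \in s -> r h <= r h0.
  by apply: seq_argmax; rewrite -size_eq0 En.
have Es := perm_to_rem h0s.
rewrite (perm_big _ Es) big_cons /= big_ord_recr /= mulrDr addrC lerD //.
  apply: IH => //; [by rewrite size_rem // En | exact: rem_uniq |].
  by move=> h /mem_rem; exact: sN.
have : (size (sA ++ s))%:R * r h0 `^ (- tau) <= S.
  apply: size_weight_le => //.
    rewrite cat_uniq uA us andbT /=; apply/hasPn => h hs; apply/negP => hA.
    by have := le_lt_trans (sAN _ hA) (sN _ hs); rewrite ltxx.
  move=> h; rewrite mem_cat => /orP[hA|]; last exact: hmax.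
  by rewrite (le_trans (sAN _ hA)) // ltW // sN.
rewrite size_cat En natrD; set a := _ + _ => h1.
have a_gt0 : 0 < a by rewrite /a -natrD ltr0n addnS.
have S0 : 0 <= S by apply: le_trans h1; rewrite mulr_ge0 ?powR_ge0 // ltW.
have h2 : r h0 `^ (- tau) <= S / a by rewrite ler_pdivlMr // mulrC.
have h3 : (r h0 `^ (- tau)) `^ tau^-1 <= (S / a) `^ tau^-1.
  by apply: ge0_ler_powR; rewrite ?nnegrE ?invr_ge0 ?powR_ge0 ?divr_ge0 // ltW.
move: h3; rewrite -powRrM mulNr divff ?gt_eqF // powR_inv1 ?(ltW (r_gt0 _)) //.
by rewrite powRM ?invr_ge0 ?(ltW a_gt0) // -(powR_inv1 (ltW a_gt0)) -powRrM mulN1r.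
Qed.

Lemma sum_weight_inv_le sA s N : (0 < size sA)%N -> uniq sA -> uniq s ->
  (forall h, h \in sA -> r h <= N) -> (forall h, h \in s -> N < r h) ->
  \sum_(h <- s) (r h)^-1 <=
  S `^ tau^-1 * ((size sA)%:R `^ (1 - tau^-1) * (tau / (1 - tau))).
Proof.
move=> a0 uA us sAN sN; apply: le_trans (sum_weight_inv_tail a0 uA us sAN sN) _.
rewrite ler_wpM2l ?powR_ge0 //.
have t1 : 1 < tau^-1 by rewrite invf_gt1.
have aR : 0 < (size sA)%:R :> R by rewrite ltr0n.
apply: le_trans (sum_powR_tail (size s) t1 aR) _.
rewrite ler_wpM2l ?powR_ge0 // le_eqVlt; apply/orP; left; apply/eqP.
by field; rewrite !gt_eqF ?subr_gt0.
Qed.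

End WeightedCounting.

Section KorobovWeight.
Context (R : realType) (d : nat) (alpha tau : R) (gamma : 'I_d -> R).
Hypotheses (alpha_gt0 : 0 < alpha) (tau_gt0 : 0 < tau) (at_gt1 : 1 < alpha * tau).
Hypothesis gamma_gt0 : forall j, 0 < gamma j.
Local Notation freq := (d.-tuple int).
Local Notation w := (weight alpha gamma).

Lemma weight_ge1 h : 1 <= w h.
Proof.
rewrite /weight; elim/big_ind: _ => [//|x y x1 y1|j _].
  by rewrite -[1]mulr1 ler_pM.
by rewrite le_max lexx.
Qed.

Lemma weight0 : w [tuple 0 | j < d] = 1.
Proof.
rewrite /weight big1 // => j _; rewrite tnth_mktuple normr0 powR0 ?gt_eqF //.
by rewrite mulr0 max_l.
Qed.

Lemma sum_weight_powR_le (s : seq freq) : uniq s ->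
  \sum_(h <- s) w h `^ (- tau) <=
  \prod_(j < d) (1 + 2 * zeta (alpha * tau) * gamma j `^ tau).
Proof.
move=> us; pose F (j : 'I_d) (n : int) : R :=
  (Num.max 1 ((gamma j)^-1 * `|n%:~R| `^ alpha)) `^ (- tau).
have m0 (j : 'I_d) (n : int) : 0 <= Num.max 1 ((gamma j)^-1 * `|n%:~R : R| `^ alpha).
  by rewrite le_max ler01.
have -> : \sum_(h <- s) w h `^ (- tau) = \sum_(h <- s) \prod_(j < d) F j (tnth h j).
  by apply: eq_bigr => h _; rewrite /weight powR_prod.
apply: sum_prod_le => // [j n|j K]; first exact: powR_ge0.
have F0 : F j 0 = 1.
  by rewrite /F normr0 powR0 ?gt_eqF // mulr0 max_l ?powR1.
have FS (n : int) (i : nat) : `|n%:~R| = i.+1%:R :> R ->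
    F j n <= gamma j `^ tau * (i.+1%:R `^ (alpha * tau))^-1.
  move=> E; rewrite /F E.
  have x0 : 0 < (gamma j)^-1 * i.+1%:R `^ alpha by rewrite mulr_gt0 ?invr_gt0 ?powR_gt0.
  rewrite powRrM.
  have -> : gamma j `^ tau / i.+1%:R `^ alpha `^ tau =
      ((gamma j)^-1 * i.+1%:R `^ alpha) `^ (- tau).
    have Eg : (gamma j)^-1 `^ tau = (gamma j `^ tau)^-1.
      by rewrite -(powR_inv1 (ltW (gamma_gt0 j))) -powRrM mulN1r powRN.
    by rewrite powRN powRM ?invr_ge0 ?powR_ge0 ?(ltW (gamma_gt0 j)) // Eg invfM invrK.
  rewrite !powRN lef_pV2 ?posrE ?powR_gt0 ?lt_max ?ltr01 //.
  apply: ge0_ler_powR; rewrite ?nnegrE ?(ltW tau_gt0) ?(ltW x0) ?m0 //.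
    by rewrite -E m0.
  by rewrite le_max lexx orbT.
rewrite F0 lerD2l.
have -> : 2 * zeta (alpha * tau) * gamma j `^ tau =
    (gamma j `^ tau + gamma j `^ tau) * zeta (alpha * tau) by ring.
apply: le_trans (ler_wpM2l _ (sum_le_zeta K at_gt1)); last by rewrite addr_ge0 ?powR_ge0.
rewrite mulr_sumr; apply: ler_sum => i _; rewrite mulrDl lerD //; apply: FS.
  by rewrite ger0_norm.
by rewrite mulrNz normrN ger0_norm.
Qed.

End KorobovWeight.
(** * Comparison of the constants *)

(** From exp (-1/6) >= 5/6 one gets exp 1 <= (6/5)^6 < 3. *)
Lemma ln3_gt1 (R : realType) : 1 < ln 3 :> R.
Proof.
rewrite -[X in X < _]expRK ltr_ln ?posrE ?expR_gt0 //.
have h := expR_ge1Dx (- 6^-1 : R).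
have h6 : (5 / 6) ^+ 6 <= expR (- 6^-1 : R) ^+ 6.
  by rewrite lerXn2r ?nnegrE ?expR_ge0 //; lra.
have E : expR (- 6^-1 : R) ^+ 6 = (expR 1)^-1.
  by rewrite -expRM_natl -expRN; congr expR; field.
move: h6; rewrite E => h6; have e0 := expR_gt0 (1 : R).
have : expR 1 * (5 / 6) ^+ 6 <= 1 :> R.
  by rewrite mulrC -ler_pdivlMr // div1r.
lra.
Qed.

(** Since M >= 3, l = ln M exceeds 1 and ln n.  Hence 1 + L < 4 l, and the upper
    bound on M gives M / (9 l) <= n; the power 9^b appears as 3^(2 b). *)
Lemma lattice_constant_lt (R : realType) (tau : R) (n L M : nat) :
  0 < tau -> tau < 1 -> (1 <= n)%N ->
  L%:R <= Num.max (3 * ln n%:R) 1 :> R -> (2 * n < M)%N ->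
  M%:R < 9 * n%:R * Num.max (ln n%:R) 1 :> R ->
  (1 + L%:R) * n%:R `^ ((tau - 1) / (2 * tau)) <
  4 * 3 `^ (tau^-1 - 1) * ln M%:R `^ ((1 + tau) / (2 * tau))
    * M%:R `^ ((tau - 1) / (2 * tau)) :> R.
Proof.
move=> t0 t1 n1 hL hM1 hM2; pose b := (1 - tau) / (2 * tau).
have b0 : 0 < b by rewrite divr_gt0 ?subr_gt0 ?mulr_gt0.
have tn : tau != 0 by rewrite gt_eqF.
have -> : (tau - 1) / (2 * tau) = - b by rewrite /b; field.
have -> : (1 + tau) / (2 * tau) = 1 + b by rewrite /b; field.
have -> : tau^-1 - 1 = 2 * b by rewrite /b; field.
have n0 : 0 < n%:R :> R by rewrite ltr0n.
have M0 : 0 < M%:R :> R by rewrite ltr0n; lia.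
have l1 : 1 < ln M%:R :> R.
  by rewrite (lt_le_trans (ln3_gt1 R)) // ler_ln ?posrE // ler_nat; lia.
set l := ln M%:R in l1 *; have l0 : 0 < l by lra.
have nl : ln n%:R < l by rewrite ltr_ln ?posrE // ltr_nat; lia.
have hmax : Num.max (ln n%:R) 1 <= l by rewrite ge_max !ltW.
have L4 : 1 + L%:R < 4 * l.
  by move: hL; rewrite le_max => /orP[h|h]; lra.
have hn : M%:R / (9 * l) <= n%:R.
  rewrite ler_pdivrMr ?mulr_gt0 // (le_trans (ltW hM2)) //.
  by rewrite mulrCA mulrA ler_wpM2l // mulr_ge0 // ltW.
have q0 : 0 < M%:R / (9 * l) by rewrite divr_gt0 ?mulr_gt0.
have hb : n%:R `^ (- b) <= (M%:R / (9 * l)) `^ (- b).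
  rewrite !powRN lef_pV2 ?posrE ?powR_gt0 //.
  by apply: ge0_ler_powR; rewrite ?nnegrE ?(ltW b0) ?(ltW n0) ?(ltW q0).
apply: (@lt_le_trans _ _ (4 * l * n%:R `^ (- b))); first by rewrite ltr_pM2r ?powR_gt0.
apply: (le_trans (ler_wpM2l _ hb)); first by rewrite mulr_ge0 // ltW.
have E : (M%:R / (9 * l)) `^ (- b) = M%:R `^ (- b) * (9 `^ b * l `^ b).
  rewrite powRM ?invr_ge0 ?mulr_ge0 ?(ltW l0) //; congr (_ * _).
  have l9 : 0 <= 9 * l by rewrite mulr_ge0 // ltW.
  by rewrite -powRM ?(ltW l0) // -(powR_inv1 l9) -powRrM mulrNN mul1r.
have -> : 3 `^ (2 * b) = 9 `^ b.
  by rewrite [LHS]powRrM powR_mulrn // -natrX.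
rewrite E powRD ?powRr1 ?(ltW l0) //; last first.
  by apply/implyP => _; rewrite gt_eqF.
by rewrite le_eqVlt; apply/orP; left; apply/eqP; ring.
Qed.

(** This is ln x <= x^delta / delta, raised to the power (1 + tau) / (2 tau). *)
Lemma ln_powR_le (R : realType) (tau delta x : R) :
  0 < tau -> 0 < delta -> 1 <= x ->
  ln x `^ ((1 + tau) / (2 * tau)) * x `^ ((tau - 1) / (2 * tau)) <=
  delta `^ (- ((1 + tau) / (2 * tau))) *
  x `^ ((1 + delta) / 2 - (1 - delta) / (2 * tau)).
Proof.
move=> t0 d0 x1; pose q := (1 + tau) / (2 * tau).
have q0 : 0 <= q by rewrite divr_ge0 ?addr_ge0 ?mulr_ge0 ?ltW.
have x0 : 0 < x by exact: lt_le_trans x1.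
have h : ln x <= x `^ delta / delta.
  rewrite ler_pdivlMr // [leLHS]mulrC -ln_powR.
  by apply/ltW/ln_sublinear; exact: powR_gt0.
have hq : ln x `^ q <= (x `^ delta / delta) `^ q.
  apply: ge0_ler_powR h; rewrite ?nnegrE ?ln_ge0 //.
  by rewrite divr_ge0 ?powR_ge0 ?(ltW d0).
apply: le_trans (ler_wpM2r (powR_ge0 _ _) hq) _.
rewrite powRM ?invr_ge0 ?powR_ge0 ?(ltW d0) // -powRrM.
have -> : delta^-1 `^ q = delta `^ (- q).
  by rewrite -(powR_inv1 (ltW d0)) -powRrM mulN1r.
rewrite mulrAC -powRD; last by apply/implyP => _; rewrite gt_eqF.
rewrite mulrC le_eqVlt; apply/orP; left; apply/eqP; congr (_ * _ `^ _).
by rewrite /q; field; rewrite gt_eqF.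
Qed.
(** * The unit ball of the Korobov space *)

Section KorobovBall.
Context (R : realType) (d : nat).
Local Notation C := R[i].
Local Notation pt := (d.-tuple (measurableTypeR R)).
Local Notation mu := (torus_measure R d).
Local Notation freq := (d.-tuple int).

(** Counting bounds the size of every finite subset, and an infinite set has
    subsets of every size. *)
Lemma finite_freq_set alpha (gamma : 'I_d -> R) (tau S N : R) : 0 < tau -> 0 < N ->
  (forall s : seq freq, uniq s -> \sum_(h <- s) weight alpha gamma h `^ (- tau) <= S) ->
  finite_set (freq_set alpha gamma N).
Proof.
move=> t0 N0 hS; apply: contrapT => inf.
pose n := (Num.truncn (S / N `^ (- tau))).+1.
have [B BA nB] := @infinite_set_fset _ _ n inf.
have h : (size (enum_fset B))%:R * N `^ (- tau) <= S.
  by apply: (size_weight_le (@weight_ge1 R d alpha gamma) t0 hS (fset_uniq B) N0) => h /BA.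
have : S / N `^ (- tau) < n%:R by rewrite truncnS_gt.
rewrite ltr_pdivrMr ?powR_gt0 // => h1.
have : n%:R * N `^ (- tau) <= S.
  by apply: le_trans h; rewrite ler_wpM2r ?powR_ge0 // ler_nat.
by move/(lt_le_trans h1); rewrite ltxx.
Qed.

Lemma card_freq_set_gt0 alpha (gamma : 'I_d -> R) (N : R) : 0 < alpha -> 1 <= N ->
  finite_set (freq_set alpha gamma N) -> (0 < card_set (freq_set alpha gamma N))%N.
Proof.
move=> a0 N1 fA; rewrite /card_set cardfs_gt0; apply/fset0Pn.
by exists [tuple 0 | j < d]; rewrite in_fset_set // inE /freq_set /= weight0.
Qed.

Lemma korobov_norm_le1 alpha (gamma : 'I_d -> R) (f : pt -> C) (s : seq freq) :
  (korobov_norm alpha gamma f <= 1)%E -> uniq s ->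
  \sum_(h <- s) weight alpha gamma h * Normc.normc (fourier_coef f h) ^+ 2 <= 1.
Proof.
move=> f1 us; pose a h := weight alpha gamma h * Normc.normc (fourier_coef f h) ^+ 2.
have a0 h : 0 <= a h.
  by rewrite mulr_ge0 ?sqr_ge0 // (le_trans ler01) // weight_ge1.
have E1 : (\esum_(h in [set: freq]) (a h)%:E <= 1)%E.
  have Epos : (0 <= \esum_(h in [set: freq]) (a h)%:E)%E.
    by apply: esum_ge0 => h _; rewrite lee_fin.
  have in0y (y : \bar R) : (0 <= y)%E -> y \in `[0%E, +oo%E].
    by move=> y0; rewrite in_itv /= y0 leey.
  have := gt0_ler_poweR (ler0n R 2) (in0y _ (poweR_ge0 _ _)) (in0y _ lee01) f1.
  by rewrite -poweRrM mulVf ?pnatr_eq0 // poweRe1 // poweR1r.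
rewrite -lee_fin; apply: le_trans E1; rewrite -sumEFin.
apply: esum_ge; exists [set` s]; last by rewrite fsbig_seq.
by split=> //; exact: finite_seq.
Qed.

(** The Cauchy-Schwarz inequality, obtained from the termwise bound
    |c| <= (B w |c|^2 + 1 / (B w)) / 2 with B the square root of Q. *)
Lemma sum_normc_le (T : eqType) (s : seq T) (w : T -> R) (c : T -> C) (Q : R) :
  (forall h, 0 < w h) -> 0 < Q ->
  \sum_(h <- s) w h * Normc.normc (c h) ^+ 2 <= 1 ->
  \sum_(h <- s) (w h)^-1 <= Q ->
  \sum_(h <- s) Normc.normc (c h) <= Num.sqrt Q.
Proof.
move=> w0 Q0 hc hw; pose B := Num.sqrt Q.
have B0 : 0 < B by rewrite sqrtr_gt0.
have BQ : B * B = Q by rewrite -expr2 sqr_sqrtr // ltW.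
have H : \sum_(h <- s) Normc.normc (c h) <=
    \sum_(h <- s) (2^-1 * B * (w h * Normc.normc (c h) ^+ 2) + 2^-1 * B^-1 * (w h)^-1).
  apply: ler_sum => h _; set x := Normc.normc (c h).
  have wn : w h != 0 by rewrite gt_eqF.
  have Bn : B != 0 by rewrite gt_eqF.
  rewrite -subr_ge0.
  have -> : 2^-1 * B * (w h * x ^+ 2) + 2^-1 * B^-1 * (w h)^-1 - x =
      (B * w h * x - 1) ^+ 2 / (2 * B * w h) by field; rewrite Bn wn.
  by rewrite divr_ge0 ?sqr_ge0 // !mulr_ge0 // ltW.
apply: (le_trans H); rewrite big_split /= -!mulr_sumr.
have h1 : 2^-1 * B * (\sum_(h <- s) w h * Normc.normc (c h) ^+ 2) <= 2^-1 * B * 1.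
  by rewrite ler_wpM2l // mulr_ge0 // ltW.
have h2 : 2^-1 * B^-1 * (\sum_(h <- s) (w h)^-1) <= 2^-1 * B^-1 * Q.
  by rewrite ler_wpM2l // mulr_ge0 ?invr_ge0 // ltW.
have h3 : 2^-1 * B^-1 * Q = 2^-1 * B by rewrite -BQ; field; rewrite gt_eqF.
rewrite -/B; lra.
Qed.

Lemma Linfty_norm_le (f : pt -> C) (b : R) :
  (\forall x \ae mu, Normc.normc (f x) <= b) -> (Linfty_norm f <= b%:E)%E.
Proof.
move=> fb; rewrite /Linfty_norm unlock /=.
have -> : (0 < torus_measure R d setT)%E by rewrite probability_setT lte01.
apply/ess_supP; apply: torus_aeS fb => x fx /=.
by rewrite lee_fin ger0_norm // normc_ge0.
Qed.

(** The continuous representative is only determined on the fundamental cube, and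
    this is all that the sampling points see. *)
Lemma continuous_repP (f G : pt -> C) : continuous_torus G ->
  (\forall x \ae mu, f x = G x) ->
  forall x : pt, continuous_rep f (mod1 x) = G (mod1 x).
Proof.
move=> cG fG; have [cg fg] : continuous_torus (continuous_rep f) /\
    \forall x \ae mu, f x = continuous_rep f x.
  exact: (xgetPex (fun=> 0) (ex_intro
    [set g : pt -> C | continuous_torus g /\ \forall x \ae mu, f x = g x] G (conj cG fG))).
apply: continuous_torus_ae_eq => //.
by apply: (torus_aeS _ (filterI fG fg)) => x [<- <-].
Qed.

Lemma lattice_approx_eq L (z : 'I_L -> freq) (m : 'I_L -> nat) (A : set freq)
    (f g : pt -> C) x : (forall y : pt, f (mod1 y) = g (mod1 y)) ->
  lattice_approx z m A f x = lattice_approx z m A g x.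
Proof.
move=> fg; apply: eq_bigr => l _; apply: eq_fsbigr => h _.
congr (_ * _); rewrite /lattice_coef; congr (_ * _); apply: eq_bigr => j _.
by rewrite /lattice_point fg.
Qed.

(** The weighted summability of the coefficients is used twice: against all of
    Z^d, to represent f by an absolutely convergent series, and against the
    complement of the index set, to bound the error of the algorithm. *)
Lemma lattice_error_korobov alpha (gamma : 'I_d -> R) (tau N : R) L
    (z : 'I_L -> freq) (m : 'I_L -> nat) (f : pt -> C)
    (A := freq_set alpha gamma N)
    (S := \prod_(j < d) (1 + 2 * zeta (alpha * tau) * gamma j `^ tau)) :
  0 < alpha -> 0 < tau -> tau < 1 -> 1 < alpha * tau ->
  (forall j, 0 < gamma j) -> 1 <= N -> (forall l, 0 < m l)%N ->
  A = \bigcup_(l in [set: 'I_L]) freq_part z m A l ->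
  korobov alpha gamma f -> (korobov_norm alpha gamma f <= 1)%E ->
  (Linfty_norm (fun x => f x - lattice_approx z m A (continuous_rep f) x)%R <=
   ((1 + L%:R) * Num.sqrt (S `^ tau^-1 *
     ((card_set A)%:R `^ (1 - tau^-1) * (tau / (1 - tau)))))%:E)%E.
Proof.
move=> a0 t0 t1 at1 g0 N1 m0 cov [Lf _] f1.
have hS s : uniq s -> \sum_(h <- s) weight alpha gamma h `^ (- tau) <= S.
  by move=> us; exact: sum_weight_powR_le.
have N0 : 0 < N by exact: lt_le_trans N1.
have finA : finite_set A by exact: finite_freq_set hS.
have w1 := @weight_ge1 R d alpha gamma.
have w0 h : 0 < weight alpha gamma h by exact: lt_le_trans (w1 h).
have S1 : 1 <= S.
  have := hS [:: [tuple 0 | j < d]] isT.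
  by rewrite big_seq1 weight0 // powR1.
have S0 : 0 < S by exact: lt_le_trans S1.
pose c h := fourier_coef f h.
have K s : uniq s -> \sum_(h <- s) weight alpha gamma h * Normc.normc (c h) ^+ 2 <= 1.
  exact: korobov_norm_le1.
have cS s : uniq s -> \sum_(h <- s) Normc.normc (c h) <= Num.sqrt S.
  move=> us; apply: (sum_normc_le w0 S0 (K _ us)); apply: le_trans (hS _ us).
  apply: ler_sum => h _; rewrite powRN lef_pV2 ?posrE ?powR_gt0 //.
  by apply: ler1_powR; rewrite ?w1 ?ltW.
have [G [e [e0 Ge]]] := summable_fourier_series cS.
have fG : \forall x \ae mu, f x = G x.
  apply: fourier_uniqueness => // [|h].
    by apply: unif_close_L1 e0 Ge _ => n; exact: L1_trig_poly.
  by rewrite (fourier_coef_series _ e0 Ge).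
have cG : continuous_torus G.
  by apply: unif_close_continuous e0 Ge _ => n; exact: continuous_trig_poly.
set Q := S `^ _ * _.
have nA : (0 < card_set A)%N.
  exact: card_freq_set_gt0.
have Q0 : 0 < Q by rewrite /Q !mulr_gt0 ?powR_gt0 ?ltr0n ?invr_gt0 ?subr_gt0.
have cQ n : \sum_(k <- enum_upto freq n | k \notin A) Normc.normc (c k) <= Num.sqrt Q.
  rewrite -big_filter; set s := [seq _ <- _ | _].
  have us : uniq s by rewrite filter_uniq // enum_upto_uniq.
  apply: (sum_normc_le w0 Q0 (K _ us)).
  apply: (sum_weight_inv_le w1 t0 t1 hS nA (fset_uniq _) us (N := N)).
    by move=> h; rewrite in_fset_set // inE.
  move=> h; rewrite mem_filter => /andP[hA _]; rewrite ltNge.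
  by apply: contra hA => hN; rewrite inE.
have repG := continuous_repP cG fG.
apply: Linfty_norm_le; apply: torus_aeS fG => x ->.
rewrite (lattice_approx_eq z m A x repG).
exact: lattice_error_series e0 Ge cQ.
Qed.

End KorobovBall.

Theorem theorem4p4 (R : realType) (d : nat) (hd : (1 <= d)%N)
  (alpha : R) (halpha : 1 < alpha)
  (gamma : 'I_d -> R)
  (hgamma_le1 : forall j, gamma j <= 1)
  (hgamma_gt0 : forall j, 0 < gamma j)
  (hgamma_dec : forall i j : 'I_d, (i <= j)%N -> gamma j <= gamma i)
  (N : R) (hN : 1 <= N)
  (L : nat) (hL : (1 <= L)%N)
  (z : 'I_L -> d.-tuple int)
  (m : 'I_L -> nat) (hm : forall l, (1 <= m l)%N)
  (A := freq_set alpha gamma N)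
  (M := card_set (multiple_rank1_lattice z m : set (d.-tuple R)))
  (hcover : A = \bigcup_(l in [set: 'I_L]) freq_part z m A l)
  (hLle : L%:R <= Num.max (3 * ln (card_set A)%:R) 1 :> R)
  (hm_eq : forall l l' : 'I_L, m l = m l')
  (hm_le : forall l : 'I_L, (m l <= 3 * card_set A)%N)
  (hM_gt : (2 * card_set A < M)%N)
  (hM_lt : M%:R < 9 * (card_set A)%:R * Num.max (ln (card_set A)%:R) 1 :> R)
  (tau : R) (htau0 : alpha^-1 < tau) (htau1 : tau < 1)
  (delta : R) (hdelta0 : 0 < delta) (hdelta1 : delta < 1) :
  (ereal_sup
     [set Linfty_norm (fun x => f x - lattice_approx z m A (continuous_rep f) x)%R
        | f in [set f | korobov alpha gamma f /\ korobov_norm alpha gamma f <= 1%:E]]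
   < (4 * 3 `^ (tau^-1 - 1)
        * ln M%:R `^ ((1 + tau) / (2 * tau))
        * M%:R `^ ((tau - 1) / (2 * tau))
        * Num.sqrt (tau / (1 - tau))
        * \prod_(j < d) (1 + 2 * zeta (alpha * tau) * gamma j `^ tau)
                          `^ (2 * tau)^-1)%:E)%E
  /\
  4 * 3 `^ (tau^-1 - 1)
    * ln M%:R `^ ((1 + tau) / (2 * tau))
    * M%:R `^ ((tau - 1) / (2 * tau))
    * Num.sqrt (tau / (1 - tau))
    * \prod_(j < d) (1 + 2 * zeta (alpha * tau) * gamma j `^ tau) `^ (2 * tau)^-1
  <=
  4 * 3 `^ (tau^-1 - 1)
    * delta `^ (- ((1 + tau) / (2 * tau)))
    * M%:R `^ ((1 + delta) / 2 - (1 - delta) / (2 * tau))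
    * Num.sqrt (tau / (1 - tau))
    * \prod_(j < d) (1 + 2 * zeta (alpha * tau) * gamma j `^ tau) `^ (2 * tau)^-1.
Proof.
have alpha0 : 0 < alpha by exact: lt_trans halpha.
have tau0 : 0 < tau by apply: lt_trans htau0; rewrite invr_gt0.
have at1 : 1 < alpha * tau by rewrite mulrC -ltr_pdivrMr // div1r.
have N0 : 0 < N by exact: lt_le_trans hN.
set S := \prod_(j < d) (1 + 2 * zeta (alpha * tau) * gamma j `^ tau) `^ (2 * tau)^-1.
have zeta0 : 0 <= zeta (alpha * tau).
  by have := sum_le_zeta 0 at1; rewrite big_ord0.
have fac0 j : 0 < 1 + 2 * zeta (alpha * tau) * gamma j `^ tau.
  by rewrite ltr_wpDr ?mulr_ge0 ?powR_ge0.
have S0 : 0 < S by apply: prodr_gt0 => j _; exact: powR_gt0.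
have n1 : (1 <= card_set A)%N.
  apply: card_freq_set_gt0 => //; apply: (finite_freq_set tau0 N0).
  by move=> s us; exact: sum_weight_powR_le us.
have M1 : 1 <= M%:R :> R by rewrite ler1n (leq_ltn_trans (leq0n _) hM_gt).
have q0 : 0 < Num.sqrt (tau / (1 - tau)) by rewrite sqrtr_gt0 divr_gt0 ?subr_gt0.
split; last first.
  rewrite !ler_pM2r // -!mulrA ler_pM2l // ler_pM2l ?powR_gt0 //.
  exact: ln_powR_le.
apply: (@le_lt_trans _ _ ((1 + L%:R) * (card_set A)%:R `^ ((tau - 1) / (2 * tau)) *
    Num.sqrt (tau / (1 - tau)) * S)%:E); last first.
  by rewrite lte_fin !ltr_pM2r //; exact: lattice_constant_lt.
apply: ge_ereal_sup => _ [f [kf f1] <-].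
apply: le_trans (lattice_error_korobov alpha0 tau0 htau1 at1 hgamma_gt0 hN hm hcover kf f1) _.
rewrite lee_fin -!mulrA ler_wpM2l ?addr_ge0 // le_eqVlt; apply/orP; left; apply/eqP.
have sq (x p : R) : Num.sqrt (x `^ p) = x `^ (p / 2).
  by rewrite -powR12_sqrt ?powR_ge0 // -powRrM.
rewrite sqrtrM ?powR_ge0 // sqrtrM ?powR_ge0 // !sq powR_prod; last first.
  by move=> j; exact: ltW.
rewrite mulrC -mulrA; congr (_ `^ _ * (_ * _)).
- by field; rewrite gt_eqF.
- by apply: eq_bigr => j _; rewrite invfM [_^-1 * _]mulrC.
Qed.
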